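(* Let $\pi:(M^{2p+1},g)\to(B^{2p},G,J)$ be a principal $S^{1}$-bundle with connection $\eta$, where $(M^{2p+1},g)$ is regular Sasaki-Einstein, $(B^{2p},G,J)$ is K\''ahler-Einstein, and $\pi$ is a Riemannian submersion. For every $h\in C^{\infty}(B,S^{2}(B))$, setting $\tilde{h}=\pi^{*}h$, one has $$\langle(\nabla^{g})^{*}\nabla^{g}\tilde{h}-2\mathring{R}^{g}\tilde{h},\,\tilde{h}\rangle=\Big(\langle(\nabla^{G})^{*}\nabla^{G}h-2\mathring{R}^{G}h,\,h\rangle+4\langle h,h\rangle+4\langle h\circ J,h\rangle\Big)\circ\pi$$ pointwise on $M$, where $h\circ J\in C^{\infty}(B,S^{2}(B))$ is defined by $(h\circ J)(X,Y)=h(JX,JY)$.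
   Context: Setting (regular Sasaki structure on a circle bundle): $(B^{2p},G,J)$ is a K\''ahler manifold of real dimension $2p$ with Riemannian metric $G$, complex structure $J$ and K\''ahler form $\Omega=G(\cdot,J\cdot)$. The map $\pi:M^{2p+1}\to B^{2p}$ is a principal $S^{1}$-bundle with a connection 1-form $\eta$ satisfying $d\eta=2\pi^{*}\Omega$, where $d\eta(X,Y)=X\eta(Y)-Y\eta(X)-\eta([X,Y])$. The vector field $\xi$ is the vertical vector field generated by the $S^{1}$-action with $\eta(\xi)=1$. The metric on $M$ is $g(X,Y)=G(\pi_{*}X,\pi_{*}Y)+\eta(X)\eta(Y)$. Every regular Sasaki manifold is of this form. It is Sasaki-Einstein if $g$ is moreover Einstein (then $Ric_{g}=2p\,g$ and $Ric_{G}=(2p+2)G$). $S^{2}(B)$ is the bundle of symmetric 2-tensors on $B$; $\nabla^{g},\nabla^{G}$ are the Levi-Civita connections of $g,G$; $\nabla^{*}\nabla=-\sum_k(\nabla_{e_k}\nabla_{e_k}-\nabla_{\nabla_{e_k}e_k})$ is the rough Laplacian; $(\mathring{R}h)_{ij}=R_{ikjl}h^{kl}$ for the respective metric, with the curvature sign convention in which $R_{ijij}$ is the sectional curvature of $\mathrm{span}(e_{i},e_{j})$. Inner products are $\langle h,h'\rangle=\sum_{i,j}h_{ij}h'_{ij}$ in an orthonormal frame for the respective metric. *)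

(* Defs.v *)
From HB Require Import structures.
From mathcomp Require Import all_boot all_order all_algebra.
From mathcomp Require Import all_classical all_reals all_analysis.
Set Implicit Arguments.
Unset Strict Implicit.
Unset Printing Implicit Defensive.
Import Order.TTheory GRing.Theory Num.Theory.
Import numFieldNormedType.Exports.
Local Open Scope classical_set_scope.
Local Open Scope ring_scope.

(* C^oo on a neighbourhood of [x], for [V] finite-dimensional: all iterated
   directional derivatives exist and are Frechet differentiable there. *)
Definition smooth_at (R : realType) (V W : normedModType R) (f : V -> W) (x : V) :=
  \forall y \near x, forall s : seq V,
    differentiable (foldr (fun v (k : V -> W) => 'D_v k) f s) y.

(* The atlas is indexed by the points of the manifold, [chart x] being a chart
   around [x]; any atlas can be indexed in this way.  [crd x] and [crdV x] are
   the chart at [x] and its inverse, total functions that are meaningful only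
   on [dom x] and on its image. *)
Record manifold (R : realType) (n : nat) := Manifold {
  carrier :> topologicalType;
  dom : carrier -> set carrier;
  crd : carrier -> carrier -> 'rV[R]_n;
  crdV : carrier -> 'rV[R]_n -> carrier;
  manifold_hausdorff : hausdorff_space carrier;
  manifold_second_countable : @second_countable carrier;
  dom_center : forall x, dom x x;
  dom_open : forall x, open (dom x);
  crd_open : forall x, open (crd x @` dom x);
  crdK : forall x y, dom x y -> crdV x (crd x y) = y;
  crd_continuous : forall x y, dom x y -> {for y, continuous (crd x)};
  crdV_continuous : forall x y, dom x y -> {for crd x y, continuous (crdV x)};
  crd_compat : forall x y z, dom x z -> dom y z ->
    smooth_at (crd y \o crdV x) (crd x z)
}.

Arguments dom {R n} _.
Arguments crd {R n _}.
Arguments crdV {R n _}.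

Section Calculus.
Context {R : realType} {n : nat} {M : manifold R n}.

Definition smooth_fun {W : normedModType R} (f : M -> W) (x : M) :=
  smooth_at (f \o crdV x) (crd x x).

(* The tangent space at [x] is ['rV[R]_n], a tangent vector being given by its
   components in the chart at [x].  [tdiff f x v] is the derivative of [f] at
   [x] along the tangent vector [v]. *)
Definition tdiff {W : normedModType R} (f : M -> W) (x : M) (v : 'rV[R]_n) : W :=
  'D_v (f \o crdV x) (crd x x).

Definition field := M -> 'rV[R]_n.

Definition vderive {W : normedModType R} (X : field) (f : M -> W) : M -> W :=
  fun x => tdiff f x (X x).

(* Vector fields are only required to be smooth around the point of interest:
   they are local fields, extended arbitrarily. *)
Definition smooth_field (X : field) (x : M) :=
  forall z : M, dom M z x -> smooth_fun (vderive X (crd z)) x.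

Definition lie (X Y : field) : field := fun x =>
  vderive X (vderive Y (crd x)) x - vderive Y (vderive X (crd x)) x.

(* Tensor fields given pointwise on tangent vectors. *)
Definition form1 := M -> 'rV[R]_n -> R.
Definition form2 := M -> 'rV[R]_n -> 'rV[R]_n -> R.
Definition endo := M -> 'rV[R]_n -> 'rV[R]_n.

Definition smooth_form1 (a : form1) :=
  (forall x (c : R) u v, a x (c *: u + v) = c * a x u + a x v) /\
  (forall x X, smooth_field X x -> smooth_fun (fun y => a y (X y) : R^o) x).

Definition smooth_endo (J : endo) :=
  (forall x (c : R) u v, J x (c *: u + v) = c *: J x u + J x v) /\
  (forall x X, smooth_field X x -> smooth_field (fun y => J y (X y)) x).

(* Smooth sections of the bundle of symmetric 2-tensors. *)
Definition sym_tensor (h : form2) :=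
  [/\ forall x (c : R) u v w, h x (c *: u + v) w = c * h x u w + h x v w,
      forall x u v, h x u v = h x v u &
      forall x X Y, smooth_field X x -> smooth_field Y x ->
        smooth_fun (fun y => h y (X y) (Y y) : R^o) x].

Definition riemannian_metric (g : form2) :=
  sym_tensor g /\ forall x u, u != 0 -> 0 < g x u u.

Definition ext_diff1 (a : form1) (X Y : field) (x : M) : R :=
  vderive X (fun y => a y (Y y) : R^o) x - vderive Y (fun y => a y (X y) : R^o) x
  - a x (lie X Y x).

Definition ext_diff2 (w : form2) (X Y Z : field) (x : M) : R :=
  vderive X (fun y => w y (Y y) (Z y) : R^o) x
  - vderive Y (fun y => w y (X y) (Z y) : R^o) x
  + vderive Z (fun y => w y (X y) (Y y) : R^o) x
  - w x (lie X Y x) (Z x) + w x (lie X Z x) (Y x) - w x (lie Y Z x) (X x).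

(* [nabla X Y] is the derivative of [Y] along [X]. *)
Record affine_connection (nabla : field -> field -> field) : Prop := {
  conn_smooth : forall x X Y, smooth_field X x -> smooth_field Y x ->
    smooth_field (nabla X Y) x;
  conn_addl : forall x X X' Y,
    smooth_field X x -> smooth_field X' x -> smooth_field Y x ->
    nabla (fun y => X y + X' y) Y x = nabla X Y x + nabla X' Y x;
  conn_scalel : forall x (f : M -> R^o) X Y,
    smooth_fun f x -> smooth_field X x -> smooth_field Y x ->
    nabla (fun y => f y *: X y) Y x = f x *: nabla X Y x;
  conn_addr : forall x X Y Y',
    smooth_field X x -> smooth_field Y x -> smooth_field Y' x ->
    nabla X (fun y => Y y + Y' y) x = nabla X Y x + nabla X Y' x;
  conn_leibniz : forall x (f : M -> R^o) X Y,
    smooth_fun f x -> smooth_field X x -> smooth_field Y x ->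
    nabla X (fun y => f y *: Y y) x = vderive X f x *: Y x + f x *: nabla X Y x
}.

Record levi_civita (g : form2) (nabla : field -> field -> field) : Prop := {
  lc_connection : affine_connection nabla;
  lc_metric : forall x X Y Z,
    smooth_field X x -> smooth_field Y x -> smooth_field Z x ->
    vderive X (fun y => g y (Y y) (Z y) : R^o) x
      = g x (nabla X Y x) (Z x) + g x (Y x) (nabla X Z x);
  lc_torsion_free : forall x X Y, smooth_field X x -> smooth_field Y x ->
    nabla X Y x - nabla Y X x = lie X Y x
}.

Definition curvature (nabla : field -> field -> field) (X Y Z : field) : field :=
  fun x => nabla X (nabla Y Z) x - nabla Y (nabla X Z) x - nabla (lie X Y) Z x.

Definition orthonormal_frame (g : form2) (E : 'I_n -> field) (x : M) :=
  (forall i, smooth_field (E i) x) /\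
  \forall y \near x, forall i j, g y (E i y) (E j y) = (i == j)%:R.

(* Ric(Y, Z) = sum_k R(Y, e_k, Z, e_k), where
   R(X, Y, Z, W) = g(R(X, Y)W, Z), so that R_ijij is a sectional curvature. *)
Definition ricci (g : form2) nabla (E : 'I_n -> field) (Y Z : field) (x : M) : R :=
  \sum_k g x (curvature nabla Y (E k) (E k) x) (Z x).

Definition einstein (g : form2) nabla (c : R) :=
  forall x E Y Z, orthonormal_frame g E x -> smooth_field Y x -> smooth_field Z x ->
    ricci g nabla E Y Z x = c * g x (Y x) (Z x).

(* Covariant 2-tensors seen as bilinear maps on vector fields, the form in which
   covariant derivatives of tensors are computed. *)
Definition ftensor := field -> field -> M -> R.

Definition on_fields (h : form2) : ftensor := fun Y Z x => h x (Y x) (Z x).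

Definition cov_diff nabla (X : field) (H : ftensor) : ftensor := fun Y Z x =>
  vderive X (H Y Z : M -> R^o) x - H (nabla X Y) Z x - H Y (nabla X Z) x.

Definition rough_laplacian nabla (E : 'I_n -> field) (H : ftensor) : ftensor :=
  fun Y Z x => - \sum_k (cov_diff nabla (E k) (cov_diff nabla (E k) H) Y Z x
                         - cov_diff nabla (nabla (E k) (E k)) H Y Z x).

(* The tensor R_ikjl h_kl, with the same sign convention as in [ricci]. *)
Definition curv_action (g : form2) nabla (E : 'I_n -> field) (H : ftensor) : ftensor :=
  fun Y Z x => \sum_k \sum_l g x (curvature nabla Y (E k) (E l) x) (Z x)
                             * H (E k) (E l) x.

Definition inner (E : 'I_n -> field) (S T : ftensor) (x : M) : R :=
  \sum_i \sum_j S (E i) (E j) x * T (E i) (E j) x.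

Definition einstein_operator (g : form2) nabla (E : 'I_n -> field) (H : ftensor)
    : ftensor := fun Y Z x =>
  rough_laplacian nabla E H Y Z x - 2 * curv_action g nabla E H Y Z x.

Definition kahler_form (G : form2) (J : endo) : form2 := fun x u v => G x u (J x v).

(* [kahler_integrable] is the vanishing of the Nijenhuis tensor. *)
Record kahler (G : form2) (J : endo) : Prop := {
  kahler_metric : riemannian_metric G;
  kahler_J_smooth : smooth_endo J;
  kahler_J2 : forall x u, J x (J x u) = - u;
  kahler_hermitian : forall x u v, G x (J x u) (J x v) = G x u v;
  kahler_integrable : forall x X Y, smooth_field X x -> smooth_field Y x ->
    let JX : field := fun y => J y (X y) in
    let JY : field := fun y => J y (Y y) in
    lie JX JY x - J x (lie JX Y x) - J x (lie X JY x) - lie X Y x = 0;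
  kahler_closed : forall x X Y Z,
    smooth_field X x -> smooth_field Y x -> smooth_field Z x ->
    ext_diff2 (kahler_form G J) X Y Z x = 0
}.

Definition comp_endo (h : form2) (J : endo) : form2 :=
  fun x u v => h x (J x u) (J x v).

End Calculus.

Arguments field {R n} M.
Arguments form1 {R n} M.
Arguments form2 {R n} M.
Arguments endo {R n} M.
Arguments ftensor {R n} M.

Section Maps.
Context {R : realType} {m n : nat} {M : manifold R m} {N : manifold R n}.

Definition smooth_map (f : M -> N) (x : M) :=
  {for x, continuous f} /\ smooth_fun (crd (f x) \o f) x.

Definition push (f : M -> N) (x : M) (v : 'rV[R]_m) : 'rV[R]_n :=
  tdiff (crd (f x) \o f) x v.

Definition pullback (f : M -> N) (h : form2 N) : form2 M :=
  fun x u v => h (f x) (push f x u) (push f x v).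

Definition riemannian_submersion (g : form2 M) (G : form2 N) (f : M -> N) :=
  [/\ forall x, smooth_map f x,
      forall y, exists x, f x = y,
      forall x w, exists v, push f x v = w &
      forall x u v,
        (forall w, push f x w = 0 -> g x u w = 0) ->
        (forall w, push f x w = 0 -> g x v w = 0) ->
        g x u v = G (f x) (push f x u) (push f x v)].

End Maps.

Section CircleBundles.
Context {R : realType} {m n : nat} {M : manifold R m} {B : manifold R n}.

(* The circle group is R / L Z with L > 0, so an action of it is an L-periodic
   action [act] of R.  The length L is left free because the action is
   parametrised so that its generator is the field on which the connection form
   takes the value 1.
   In [pb_locally_trivial], (b, t) |-> act t (sec b) is the equivariant
   diffeomorphism from U x R / L Z to the inverse image of U; its inverse is
   x |-> (pi x, tau x mod L), with [tau] a local lift to R of the fibre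
   coordinate. *)
Record principal_circle_bundle (pi : M -> B) (L : R) (act : R -> M -> M) : Prop := {
  pb_length : 0 < L;
  pb_act0 : forall x, act 0 x = x;
  pb_actD : forall s t x, act (s + t) x = act s (act t x);
  pb_free : forall t x, act t x = x <-> exists k : int, t = k%:~R * L;
  pb_act_continuous : continuous (fun q : R * M => act q.1 q.2);
  pb_act_smooth : forall (t : R) (x : M),
    smooth_at (fun q : R^o * 'rV[R]_m => crd (act t x) (act q.1 (crdV x q.2)))
      (t : R^o, crd x x);
  pb_proj_smooth : forall x, smooth_map pi x;
  pb_proj_act : forall t x, pi (act t x) = pi x;
  pb_locally_trivial : forall b : B, exists (U : set B) (sec : B -> M),
    [/\ open U, U b,
        forall b', U b' -> smooth_map sec b' /\ pi (sec b') = b' &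
        forall x, U (pi x) -> exists tau : M -> R^o,
          smooth_fun tau x /\ \forall y \near x, y = act (tau y) (sec (pi y))]
}.

Definition generator (act : R -> M -> M) : field M :=
  fun x => 'D_1 (fun t : R^o => crd x (act t x)) 0.

Record connection_form (act : R -> M -> M) (eta : form1 M) : Prop := {
  cf_smooth : smooth_form1 eta;
  cf_generator : forall x, eta x (generator act x) = 1;
  cf_invariant : forall t x u, eta (act t x) (push (act t) x u) = eta x u
}.

Record regular_sasaki (g : form2 M) (G : form2 B) (J : endo B)
    (pi : M -> B) (L : R) (act : R -> M -> M) (eta : form1 M) : Prop := {
  rs_kahler : kahler G J;
  rs_bundle : principal_circle_bundle pi L act;
  rs_connection : connection_form act eta;
  rs_curvature : forall x X Y, smooth_field X x -> smooth_field Y x ->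
    ext_diff1 eta X Y x = 2 * pullback pi (kahler_form G J) x (X x) (Y x);
  rs_metric : riemannian_metric g;
  rs_metricE : forall x u v, g x u v = pullback pi G x u v + eta x u * eta x v
}.

End CircleBundles.

(* Main.v *)
Require Import Defs.
From HB Require Import structures.
From mathcomp Require Import all_boot all_order all_algebra.
From mathcomp Require Import all_classical all_reals all_analysis.
From mathcomp Require Import ring lra.
Import Order.TTheory GRing.Theory Num.Theory.
Import numFieldNormedType.Exports.
Set Implicit Arguments.
Unset Strict Implicit.
Unset Printing Implicit Defensive.
Local Open Scope classical_set_scope.
Local Open Scope ring_scope.

(** The identity compares the geometry of [M] with that of [B], and the two differ
    only through the curvature of the bundle.  Write [X], [Y], [Z] both for fields on
    [B] and for their horizontal lifts, and [xi] for the vertical field with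
    [eta xi = 1].  Since [d eta] is twice the pulled back Kaehler form, the bracket
    of two lifts is the lift of the bracket plus [2 G (J X) Y] times [xi], and the
    Koszul formula gives
      - [Dg X Y] is the lift of [DG X Y] plus [G (J X) Y] times [xi],
      - [Dg X xi] and [Dg xi X] are both minus the lift of [J X],
      - [Dg xi xi] vanishes
    ([nabla_hlift], [nabla_hlift_reeb], [nabla_reeb_hlift], [nabla_reeb_reeb]).

    Let [k] be the pull-back of [h].  It vanishes on [xi], so in the inner product
    with [k] only lifts matter as arguments, and it remains to compare the
    Einstein operators on them.  Take the lifts of an orthonormal frame [F] of [B],
    completed by [xi].
      - In the directions of the lifts, the second covariant derivative of [k] differs
        from that of [h] by two terms, because [Dg (F i) Y] has a vertical part and
        the derivative of [k] on [xi] is [h (J X) Z] ([hessian_hlift]).  Summed over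
        the frame they give [- 2 h].
      - In the direction [xi], the derivative of [k] is [h (J Y) Z + h Y (J Z)], and
        the second derivative is [- 2 h + 2 h (J, J)] ([hessian_reeb]).
      - The horizontal curvature is given by O'Neill's formula ([push_curvature]), and
        contracting the corrections with the symmetric [h] gives [- 3 h (J, J)].
    The rough Laplacian thus contributes [4 h - 2 h (J, J)] and the curvature term
    [6 h (J, J)], together [4 h + 4 h (J, J)].

    The frames in the statement are arbitrary, so the sums must be shown not to
    depend on them ([inner_einstein_frame]).  This follows from tensoriality: what is
    linear over smooth functions only depends on the values of the fields at the point
    ([tensorial_frame]).  Fields are smooth only around the point of interest, which
    turns out to be an advantage, since a function that is constant on a
    neighbourhood and discontinuous elsewhere may serve as a cut-off
    ([tensorial_congr]).

    The analysis consists of the stability of smoothness under sums, products and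
    composition, and of the symmetry of second derivatives ([derive_swap]), which makes
    the bracket a commutator of derivations ([diffR_lie]) and compatible with the
    projection ([push_lie]). *)

(** * Smooth functions on normed spaces *)

Section SmoothCalculus.
Context {R : realType}.
Implicit Types V W : normedModType R.

Lemma near_eq_differentiable {V W} (f g : V -> W) x :
  {near x, f =1 g} -> differentiable f x -> differentiable g x.
Proof.
move=> fg df; have fgx := nbhs_singleton fg.
have [dfc /eqaddoP dfE] := (diff_locallyP x f).1 df.
have gE : g \o shift x = cst (g x) + 'd f x +o_ 0 id.
  apply/eqaddoP => e e0; move: fg; rewrite nbhs0P => fg.
  apply: filterS2 fg (dfE e e0) => h /= fgh.
  by rewrite !fctE /= [h + x]addrC fgh fgx.
have dgE := diff_unique dfc gE.
by apply/diff_locallyP; rewrite dgE.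
Qed.

(** Class [C^k] on [U].  The first derivative taken is the innermost one, whereas
    [smooth_at] lists the outermost first: closure under products and composition
    is an induction that differentiates the given functions once and then applies
    to the results. *)
Fixpoint Ck {V W} (k : nat) (U : set V) (f : V -> W) : Prop :=
  (forall y, U y -> differentiable f y) /\
  if k is k'.+1 then forall v, Ck k' U ('D_v f) else True.

Lemma Ck_differentiable {V W} k U (f : V -> W) y :
  U y -> Ck k U f -> differentiable f y.
Proof. by move=> Uy; case: k => [|k] [+ _]; apply. Qed.

Lemma CkP {V W} k U (f : V -> W) : Ck k U f <->
  (forall s : seq V, (size s <= k)%N -> forall y, U y ->
     differentiable (foldr (fun v (k : V -> W) => 'D_v k) f s) y).
Proof.
elim: k f => [|k IH] f /=.
  by split=> [[df _] [|]//|df]; split=> //; exact: (df [::]).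
split=> [[df dDf] s|df].
  case/lastP: s => [_|s v]; first exact: df.
  by rewrite size_rcons ltnS foldr_rcons => sk; move/IH: (dDf v); exact.
split; first exact: (df [::]).
move=> v; apply/IH => s sk; have := df (rcons s v).
by rewrite size_rcons ltnS foldr_rcons; exact.
Qed.

Lemma Ck_congr {V W} k U (f g : V -> W) : open U ->
  (forall y, U y -> f y = g y) -> Ck k U f -> Ck k U g.
Proof.
move=> oU.
have nU y (f' g' : V -> W) : (forall y, U y -> f' y = g' y) -> U y ->
    {near y, f' =1 g'}.
  by move=> fg Uy; apply: filterS (open_nbhs_nbhs (conj oU Uy)).
elim: k f g => [|k IH] f g fg [df dDf].
  by split=> // y Uy; apply: near_eq_differentiable (df _ Uy); exact: nU.
split=> [y Uy|v]; first by apply: near_eq_differentiable (df _ Uy); exact: nU.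
apply: IH (dDf v) => y Uy; apply: near_eq_derive; exact: nU.
Qed.

Lemma Ck_leS {V W} k U (f : V -> W) : Ck k.+1 U f -> Ck k U f.
Proof. by move=> /CkP Cf; apply/CkP => s sk; apply: Cf; exact: leqW. Qed.

Lemma Ck_cst {V W} k U (a : W) : Ck k U (cst a : V -> W).
Proof.
elim: k a => [|k IH] a; split=> // v.
by rewrite (_ : 'D_v _ = cst 0)//; apply/funext => y; exact: derive_cst.
Qed.

Lemma Ck_add {V W} k U (f g : V -> W) : open U ->
  Ck k U f -> Ck k U g -> Ck k U (f + g).
Proof.
move=> oU; elim: k f g => [|k IH] f g Cf Cg.
  by split=> // y Uy; apply: differentiableD;
    [exact: Ck_differentiable Cf|exact: Ck_differentiable Cg].
split=> [y Uy|v].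
  by apply: differentiableD; [exact: Ck_differentiable Cf|exact: Ck_differentiable Cg].
apply: (@Ck_congr _ _ _ _ ('D_v f + 'D_v g)) => //; last first.
  by case: Cf => _ Df; case: Cg => _ Dg; apply: IH; [exact: Df|exact: Dg].
by move=> y Uy; rewrite deriveD//; apply: diff_derivable;
  [exact: Ck_differentiable Cf|exact: Ck_differentiable Cg].
Qed.

(** Leibniz: one derivative of a product is a sum of products of functions that
    are still [C^k]. *)
Lemma Ck_mul {V} k U (f g : V -> R^o) : open U ->
  Ck k U f -> Ck k U g -> Ck k U (fun y => f y * g y : R^o).
Proof.
move=> oU; elim: k f g => [|k IH] f g Cf Cg.
  by split=> // y Uy; apply: differentiableM;
    [exact: Ck_differentiable Cf|exact: Ck_differentiable Cg].
split=> [y Uy|v].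
  by apply: differentiableM; [exact: Ck_differentiable Cf|exact: Ck_differentiable Cg].
have [_ /(_ v) Df] := Cf; have [_ /(_ v) Dg] := Cg.
apply: (@Ck_congr _ _ _ _ ((fun y => f y * 'D_v g y : R^o) +
   (fun y => g y * 'D_v f y : R^o))) => //; last first.
  by apply: Ck_add => //; apply: IH => //; exact: Ck_leS.
by move=> y Uy; rewrite [RHS]deriveM//; apply: diff_derivable;
  [exact: Ck_differentiable Cf|exact: Ck_differentiable Cg].
Qed.

Lemma Ck_sum {V W} k U n (f : 'I_n -> V -> W) : open U ->
  (forall i, Ck k U (f i)) -> Ck k U (\sum_i f i).
Proof.
move=> oU Cf; elim/big_ind: _ => //; first exact: Ck_cst.
by move=> *; exact: Ck_add.
Qed.

Lemma derive_coord {V m n} (f : V -> 'M[R]_(m, n)) i j v y :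
  differentiable f y -> 'D_v (fun z => f z i j : R^o) y = ('D_v f y) i j.
Proof. by move=> df; rewrite derive_mx ?mxE//; exact: diff_derivable. Qed.

Lemma differentiable_coords {V n} (f : V -> 'rV[R]_n) y :
  differentiable f y <-> forall i, differentiable (fun z => f z 0 i : R^o) y.
Proof.
split=> [df i|df].
  by apply: (differentiable_comp df (differentiable_coord _ _ _)).
rewrite (_ : f = \sum_i (fun z => f z 0 i *: delta_mx 0 i)).
  by apply: differentiable_sum => i; exact: differentiableZl.
by apply/funext => z; rewrite fct_sumE [LHS]row_sum_delta.
Qed.

Lemma Ck_coords {V n} k U (f : V -> 'rV[R]_n) : open U ->
  Ck k U f <-> forall i, Ck k U (fun z => f z 0 i : R^o).
Proof.
move=> oU; elim: k f => [|k IH] f.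
  split=> [[df _] i|df]; split=> // y Uy.
    by move/differentiable_coords: (df y Uy); exact.
  by apply/differentiable_coords => i; case: (df i) => + _; exact.
split=> [[df Cf] i|Cf].
  split=> [y Uy|v]; first by move/differentiable_coords: (df y Uy); exact.
  move/IH: (Cf v) => /(_ i); apply: Ck_congr => // y Uy.
  by rewrite derive_coord//; exact: df.
have df y : U y -> differentiable f y.
  by move=> Uy; apply/differentiable_coords => i; case: (Cf i) => + _; exact.
split=> // v; apply/IH => i; have [_ /(_ v)] := Cf i.
by apply: Ck_congr => // y Uy; rewrite derive_coord//; exact: df.
Qed.

(** The chain rule in coordinates: the derivatives of a composite are sums of
    products, which makes composition accessible to induction on [k]. *)
Lemma derive_comp_coord {V m} (f : V -> 'rV[R]_m) (g : 'rV[R]_m -> R^o) v y :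
  differentiable f y -> differentiable g (f y) ->
  'D_v (g \o f) y = \sum_i 'D_v f y 0 i * 'D_(delta_mx 0 i) g (f y).
Proof.
move=> df dg; rewrite deriveE; last exact: differentiable_comp.
rewrite diff_comp//= -(deriveE v df).
transitivity ('d g (f y) (\sum_i 'D_v f y 0 i *: delta_mx 0 i)).
  by rewrite -row_sum_delta.
rewrite linear_sum; apply: eq_bigr => i _.
by rewrite (deriveE _ dg) linearZ.
Qed.

Lemma Ck_comp {V m} k U U' (f : V -> 'rV[R]_m) (g : 'rV[R]_m -> R^o) :
  open U -> open U' -> (forall y, U y -> U' (f y)) ->
  Ck k U f -> Ck k U' g -> Ck k U (g \o f).
Proof.
move=> oU oU' UU'.
have dgf k' f' g' y : Ck k' U f' -> Ck k' U' g' -> U y -> U' (f' y) ->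
    differentiable (g' \o f' : V -> R^o) y.
  by move=> Cf Cg Uy U'y; apply: differentiable_comp;
    [exact: Ck_differentiable Cf|exact: Ck_differentiable Cg].
elim: k g => [|k IH] g Cf Cg.
  by split=> // y Uy; apply: (dgf 0%N) => //; exact: UU'.
split=> [y Uy|v]; first by apply: (dgf k.+1) => //; exact: UU'.
apply: (@Ck_congr _ _ _ _ (\sum_i
  (fun y => 'D_v f y 0 i * ('D_(delta_mx 0 i) g \o f) y : R^o))) => //.
  move=> y Uy; rewrite fct_sumE derive_comp_coord//.
    exact: Ck_differentiable Cf.
  exact: Ck_differentiable (UU' _ Uy) Cg.
apply: Ck_sum => // i; apply: Ck_mul => //.
  by have [_ /(_ v)] := Cf; move=> /(Ck_coords _ _ oU); exact.
by case: Cg => _ Dg; apply: IH; [exact: Ck_leS|exact: Dg].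
Qed.

Lemma smooth_atP {V W} (f : V -> W) x : smooth_at f x <->
  exists U, [/\ open U, U x & forall k, Ck k U f].
Proof.
split=> [|[U [oU Ux Cf]]].
  rewrite /smooth_at => /nbhs_interior nf.
  exists ([set y | forall s : seq V,
    differentiable (foldr (fun v (k : V -> W) => 'D_v k) f s) y]^°); split.
  - exact: open_interior.
  - exact: nbhs_singleton nf.
  - by move=> k; apply/CkP => s _ y /interior_subset; exact.
apply: filterS (open_nbhs_nbhs (conj oU Ux)) => y Uy s.
by have /CkP := Cf (size s); exact.
Qed.

(** A convenient way to prove smoothness: choose a condition that holds around the
    point and work on the open sets where it holds everywhere. *)
Lemma smooth_at_on {V W} (P : set V) (f : V -> W) x :
  (\forall y \near x, P y) ->
  (forall U, open U -> U `<=` P -> forall k, Ck k U f) -> smooth_at f x.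
Proof.
move=> /nbhs_interior nP Cf; apply/smooth_atP; exists P^°; split.
- exact: open_interior.
- exact: nbhs_singleton nP.
- by apply: Cf; [exact: open_interior|exact: interior_subset].
Qed.

Lemma smooth_at_near {V W} (f : V -> W) x :
  smooth_at f x -> \forall y \near x, smooth_at f y.
Proof. by move=> /near_join. Qed.

Lemma smooth_at_differentiable {V W} (f : V -> W) x :
  smooth_at f x -> differentiable f x.
Proof. by move=> /nbhs_singleton/(_ [::]). Qed.

Lemma smooth_at_congr {V W} (f g : V -> W) x :
  {near x, f =1 g} -> smooth_at f x -> smooth_at g x.
Proof.
move=> fg /nbhs_interior sf.
apply: (smooth_at_on (filterI fg (nbhs_interior (nbhs_singleton sf)))).
move=> U oU UP k; apply: (@Ck_congr _ _ _ _ f) => // [y /UP[]//|].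
by apply/CkP => s _ y /UP[_ /interior_subset]; exact.
Qed.

Lemma smooth_at_derive {V W} (f : V -> W) x v :
  smooth_at f x -> smooth_at ('D_v f) x.
Proof.
by apply: filterS => y df s; have := df (rcons s v); rewrite foldr_rcons.
Qed.

Lemma smooth_at_cst {V W} (a : W) x : smooth_at (cst a : V -> W) x.
Proof.
by apply/smooth_atP; exists setT; split=> //; [exact: openT|move=> k; exact: Ck_cst].
Qed.

Lemma Ck_subset {V W} k (U U' : set V) (f : V -> W) :
  U `<=` U' -> Ck k U' f -> Ck k U f.
Proof. by move=> UU' /CkP Cf; apply/CkP => s sk y /UU'; exact: Cf. Qed.

Lemma smooth_at_add {V W} (f g : V -> W) x :
  smooth_at f x -> smooth_at g x -> smooth_at (fun y => f y + g y) x.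
Proof.
move=> /smooth_atP[U [oU Ux Cf]] /smooth_atP[U' [oU' U'x Cg]].
apply/smooth_atP; exists (U `&` U'); split=> [||k] //; first exact: openI.
by apply: Ck_add; [exact: openI|exact: Ck_subset (Cf k)|exact: Ck_subset (Cg k)].
Qed.

Lemma smooth_at_mul {V} (f g : V -> R^o) x :
  smooth_at f x -> smooth_at g x -> smooth_at (fun y => f y * g y : R^o) x.
Proof.
move=> /smooth_atP[U [oU Ux Cf]] /smooth_atP[U' [oU' U'x Cg]].
apply/smooth_atP; exists (U `&` U'); split=> [||k] //; first exact: openI.
by apply: Ck_mul; [exact: openI|exact: Ck_subset (Cf k)|exact: Ck_subset (Cg k)].
Qed.

Lemma smooth_at_sum {V W} n (f : 'I_n -> V -> W) x :
  (forall i, smooth_at (f i) x) -> smooth_at (fun y => \sum_i f i y) x.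
Proof.
move=> sf; rewrite (_ : (fun y => _) = \sum_i f i); last first.
  by apply/funext => y; rewrite fct_sumE.
elim/big_ind: _ => // [|f1 f2]; first exact: smooth_at_cst.
exact: smooth_at_add.
Qed.

Lemma smooth_at_coords {V n} (f : V -> 'rV[R]_n) x :
  smooth_at f x <-> forall i, smooth_at (fun z => f z 0 i : R^o) x.
Proof.
split=> [/smooth_atP[U [oU Ux Cf]] i|sf].
  apply/smooth_atP; exists U; split=> // k.
  by move: (Cf k) => /(Ck_coords _ _ oU); exact.
have : \forall y \near x, forall i (s : seq V), differentiable
    (foldr (fun v (k : V -> R^o) => 'D_v k) (fun z => f z 0 i : R^o) s) y.
  exact: filter_forall.
move=> /smooth_at_on; apply => U oU UP k; apply/(Ck_coords _ _ oU) => i.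
by apply/CkP => s _ y /UP /(_ i); exact.
Qed.

(** The neighbourhood on which the composite is smooth is fixed before the number of
    derivatives: [f] is smooth on it and maps it to where [g] is smooth. *)
Lemma smooth_at_comp {V m} (f : V -> 'rV[R]_m) (g : 'rV[R]_m -> R^o) x :
  smooth_at f x -> smooth_at g (f x) -> smooth_at (g \o f) x.
Proof.
move=> sf /smooth_atP[U' [oU' U'x Cg]].
have cf := differentiable_continuous (smooth_at_differentiable sf).
move: sf => /smooth_atP[U [oU Ux Cf]].
have : \forall y \near x, U y /\ U' (f y).
  apply: filterI; first exact: open_nbhs_nbhs.
  by apply: cf; exact: open_nbhs_nbhs.
move=> /smooth_at_on; apply => O oO OP k.
apply: (@Ck_comp _ _ _ _ U') => // [y /OP[]//|].
by apply: Ck_subset (Cf k) => y /OP[].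
Qed.

End SmoothCalculus.

(** * Symmetry of second derivatives *)

Section Schwarz.
Context {R : realType}.
Implicit Types V : normedModType R.

Lemma is_derive_line {V} (f : V -> R^o) z v (s : R) :
  differentiable f (z + s *: v) ->
  is_derive (s : R^o) 1 (fun u : R^o => f (z + u *: v)) ('D_v f (z + s *: v)).
Proof.
move=> df.
have dl : is_diff (s : R^o) ((cst z : R^o -> V) + *:%R^~ v) (0 + *:%R^~ v).
  exact: is_diffD.
have dlf : differentiable (f : V -> R^o) (((cst z : R^o -> V) + *:%R^~ v) s).
  exact: df.
have dc := differentiable_comp (@ex_diff _ _ _ _ _ _ _ dl) dlf.
split; first exact: diff_derivable.
rewrite (deriveE _ dc) (diff_comp (@ex_diff _ _ _ _ _ _ _ dl) dlf) /=.
by rewrite diff_val/= !fctE scale1r add0r (deriveE _ df).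
Qed.

(** By the mean value theorem along [v], the second difference is [t] times the
    increment of [D_v f] between [x + sv] and [x + tw + sv] for some [s] in [0, t].
    The differential of [D_v f] at [x] turns that increment into [t D_w D_v f x] up
    to [o(t)]. *)
Lemma second_difference {V} (f : V -> R^o) x v w e :
  (\forall y \near x, differentiable f y) -> differentiable ('D_v f) x -> 0 < e ->
  \forall t \near 0^'+,
    `|f (x + t *: v + t *: w) - f (x + t *: v) - f (x + t *: w) + f x
      - t ^+ 2 * 'D_w ('D_v f) x| <= e * t ^+ 2.
Proof.
move=> df dDf e0; set D := 'D_v f in dDf *.
(* [t * c] bounds every displacement that occurs; the [1] keeps [c] positive.  The
   differential is used at two points, whence the factor 2 in [e / (2 * c)]. *)
set c := `|v| + `|w| + 1.
have c0 : 0 < c by rewrite /c; have := normr_ge0 v; have := normr_ge0 w; lra.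
have e'0 : 0 < e / (2 * c) by rewrite divr_gt0// mulr_gt0.
have [dDc /eqaddoP/(_ _ e'0) DE] := (diff_locallyP x D).1 dDf.
move: df; rewrite nbhs0P => df.
have [d /= d0 dP] := nbhs_norm0P.1 (filterI df DE).
near=> t.
have t0 : 0 < t by near: t; exact: nbhs_right_gt.
have td : t * c < d.
  by rewrite -ltr_pdivlMr//; near: t; apply: nbhs_right_lt; rewrite divr_gt0.
have kP (s u : R) : 0 <= s <= t -> 0 <= u <= t ->
    `|s *: v + u *: w| <= t * c /\ `|s *: v + u *: w| < d.
  move=> /andP[s0 st] /andP[u0 ut].
  suff le : `|s *: v + u *: w| <= t * c by split=> //; exact: le_lt_trans td.
  rewrite (le_trans (ler_normD _ _))// !normrZ !ger0_norm//.
  have := ler_wpM2r (normr_ge0 v) st; have := ler_wpM2r (normr_ge0 w) ut.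
  by rewrite /c; nra.
have dfk (s u : R) : 0 <= s <= t -> 0 <= u <= t ->
    differentiable f (x + u *: w + s *: v).
  move=> st ut; have [_ kd] := kP _ _ st ut.
  by have [+ _] := dP _ kd; rewrite [in X in _ -> X]addrAC -addrA.
have rk (s u : R) : 0 <= s <= t -> 0 <= u <= t ->
    `|D (x + u *: w + s *: v) - D x - 'd D x (s *: v + u *: w)|
      <= e / (2 * c) * (t * c).
  move=> st ut; have [kc kd] := kP _ _ st ut.
  have [_] := dP _ kd; rewrite !fctE /= => H.
  have -> : x + u *: w + s *: v = s *: v + u *: w + x.
    by rewrite [LHS]addrC -[RHS]addrA; congr (_ + _); exact: addrC.
  rewrite -[X in `|X|]addrA -opprD.
  by rewrite (le_trans H)// ler_wpM2l// ltW.
have t0t : 0 <= t <= t by rewrite lexx ltW.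
have t00 : 0 <= (0 : R) <= t by rewrite lexx ltW.
pose phi (s : R) : R := f (x + t *: w + s *: v) - f (x + 0 *: w + s *: v).
pose dphi (s : R) : R := D (x + t *: w + s *: v) - D (x + 0 *: w + s *: v).
have dphiE (s : R) : 0 <= s <= t -> is_derive (s : R^o) 1 (phi : R^o -> R^o) (dphi s).
  move=> st; have d1 := is_derive_line (dfk _ _ st t0t).
  have d2 := is_derive_line (dfk _ _ st t00).
  exact: is_deriveB d1 d2.
have [||s st E] := @MVT R phi dphi 0 t t0.
- by move=> s; rewrite in_itv/= => /andP[s0 st]; apply: dphiE; rewrite !ltW.
- apply: derivable_within_continuous => s; rewrite in_itv/= => st.
  by have [] := dphiE _ st.
have {}st : 0 <= s <= t by move: st; rewrite in_itv/= => /andP[s0 st]; rewrite !ltW.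
have r1 := rk _ _ st t0t; have r2 := rk _ _ st t00.
move: E; rewrite /phi /dphi subr0 !scale0r !addr0 => E.
have lin (a b : R) : 'd D x (a *: v + b *: w) = a * 'd D x v + b * 'd D x w :> R.
  by rewrite linearD !linearZ.
have ctE : e / (2 * c) * (t * c) = e * t / 2 by field; rewrite gt_eqF.
move: r1 r2; rewrite !lin ctE scale0r !addr0 => r1 r2.
have -> : f (x + t *: v + t *: w) - f (x + t *: v) - f (x + t *: w) + f x =
  (D (x + t *: w + s *: v) - D (x + s *: v)) * t.
  by rewrite -E [x + t *: v + _]addrAC; ring.
rewrite (deriveE _ dDf).
set A := D (_ + s *: v) in r1 E *; set B := D _ in r2 E *.
set lw : R := 'd D x w in r1 r2 *; set lv : R := 'd D x v in r1 r2.
have -> : (A - B) * t - t ^+ 2 * lw =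
    t * ((A - D x - (s * lv + t * lw)) - (B - D x - (s * lv + 0 * lw))) :> R.
  by ring.
rewrite normrM gtr0_norm// expr2 mulrCA ler_pM2l//.
by rewrite (le_trans (ler_normB _ _))//; lra.
Unshelve. all: by end_near. Qed.

(** Young's theorem: the second difference is symmetric in [v] and [w], so both
    iterated derivatives are its limit after division by [t^2]. *)
Lemma derive_swap {V} (f : V -> R^o) x v w :
  smooth_at f x -> 'D_w ('D_v f) x = 'D_v ('D_w f) x.
Proof.
move=> sf.
have df : \forall y \near x, differentiable f y.
  by near=> y; apply: smooth_at_differentiable; near: y; exact: smooth_at_near.
have dD u : differentiable ('D_u f) x.
  exact: smooth_at_differentiable (smooth_at_derive _ sf).
apply/eqP; rewrite -subr_eq0 -normr_le0; apply/ler_addgt0Pl => e e0.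
rewrite addr0; have e20 : 0 < e / 2 by rewrite divr_gt0.
have H1 := second_difference w df (dD v) e20.
have H2 := second_difference v df (dD w) e20.
have [t [[/= + +] t0]] := filter_ex (filterI (filterI H1 H2) (nbhs_right_gt (0 : R))).
rewrite [x + t *: w + _]addrAC.
have t2 : 0 < t ^+ 2 by exact: exprn_gt0.
move: ('D_w _ _) ('D_v _ _) (f _) (f _) (f _) (f _) => a b Fx Fw Fv F.
move=> h1 h2; rewrite -(ler_pM2l t2) -[X in X * `|_|]gtr0_norm// -normrM.
have -> : t ^+ 2 * (a - b) = (F - Fw - Fv + Fx - t ^+ 2 * b)
    - (F - Fv - Fw + Fx - t ^+ 2 * a) by ring.
rewrite (le_trans (ler_normB _ _))//; lra.
Unshelve. all: by end_near. Qed.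
End Schwarz.

(** * Calculus on manifolds *)

(** The algebra behind the commutator of two derivations, with [a], [b] the
    components of the two fields, [c] the first and [d] the second partial
    derivatives of the function. *)
Lemma commutator_sum {R : realType} n (A B a b c : 'I_n -> R) (d : 'I_n -> 'I_n -> R) :
  (forall i j, d i j = d j i) ->
  \sum_i A i * c i + \sum_i \sum_j b i * (a j * d i j)
    - (\sum_i B i * c i + \sum_i \sum_j a i * (b j * d i j))
  = \sum_i (A i - B i) * c i.
Proof.
move=> dC; have -> : \sum_i \sum_j b i * (a j * d i j) = \sum_i \sum_j a i * (b j * d i j).
  rewrite exchange_big; apply: eq_bigr => i _; apply: eq_bigr => j _ /=.
  by rewrite dC mulrCA.
by rewrite opprD addrACA subrr addr0 -sumrB; apply: eq_bigr => i _; rewrite mulrBl.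
Qed.

Section ManifoldCalculus.
Context {R : realType} {n : nat} {M : manifold R n}.
Implicit Types (x y z b : M) (X Y Z : field M).

Lemma near_crdV x y (P : M -> Prop) : dom M x y ->
  (\forall z \near y, P z) -> \forall u \near crd x y, P (crdV x u).
Proof. by move=> xy; rewrite -{1}(crdK xy) => Py; exact: (crdV_continuous xy). Qed.

Lemma near_crd x y (P : 'rV[R]_n -> Prop) : dom M x y ->
  (\forall u \near crd x y, P u) -> \forall z \near y, P (crd x z).
Proof. by move=> xy Py; exact: (crd_continuous xy). Qed.

Lemma near_dom x y : dom M x y -> \forall z \near y, dom M x z.
Proof. by move=> xy; apply: open_nbhs_nbhs; split=> //; exact: dom_open. Qed.

Lemma crdVK_near x y : dom M x y -> \forall u \near crd x y, crd x (crdV x u) = u.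
Proof.
move=> xy.
have : \forall u \near crd x y, (crd x @` dom M x) u.
  by apply: open_nbhs_nbhs; split; [exact: crd_open|exists y].
by apply: filterS => u [z xz <-]; rewrite crdK.
Qed.

Lemma smooth_fun_congr {W : normedModType R} (f h : M -> W) x :
  {near x, f =1 h} -> smooth_fun f x -> smooth_fun h x.
Proof. by move=> /(near_crdV (dom_center x)); exact: smooth_at_congr. Qed.

Lemma tdiff_congr {W : normedModType R} (f h : M -> W) x v :
  {near x, f =1 h} -> tdiff f x v = tdiff h x v.
Proof. by move=> /(near_crdV (dom_center x)); exact: near_eq_derive. Qed.

(** The inverse of the chart at [b] cancels only inside [dom b], so reading a
    function in two charts gives the same result up to the transition map on a
    neighbourhood, not everywhere. *)
Lemma chart_change {W : normedModType R} (f : M -> W) b y z :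
  dom M b z -> dom M y z ->
  {near crd y z, (f \o crdV b) \o (crd b \o crdV y) =1 f \o crdV y}.
Proof.
move=> bz yz; have := near_crdV yz (near_dom bz).
by apply: filterS => u bu /=; rewrite crdK.
Qed.

Lemma smooth_fun_chart (f : M -> R^o) b y : dom M b y ->
  smooth_fun f y <-> smooth_at (f \o crdV b) (crd b y).
Proof.
move=> bY; have yy := dom_center y; split=> sf.
  apply: smooth_at_congr (chart_change f yy bY) _.
  by apply: smooth_at_comp; [exact: crd_compat|rewrite /= crdK].
apply: smooth_at_congr (chart_change f bY yy) _.
by apply: smooth_at_comp; [exact: crd_compat|rewrite /= crdK].
Qed.

(** The three notions below restrict [smooth_fun], [tdiff] and [vderive] to scalar
    functions typed [M -> R] rather than [M -> R^o], so that the algebra on their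
    values takes place in [R]. *)
Definition smoothR (f : M -> R) (x : M) : Prop := @smooth_fun R n M R^o f x.
Definition diffR (f : M -> R) (x : M) (v : 'rV[R]_n) : R := @tdiff R n M R^o f x v.
Definition derR (X : field M) (f : M -> R) : M -> R := @vderive R n M R^o X f.

Implicit Types f h : M -> R.

Lemma smoothR_coords {m} (f : M -> 'rV[R]_m) x :
  smooth_fun f x <-> forall i, smoothR (fun y => f y 0 i) x.
Proof. exact: smooth_at_coords. Qed.

Lemma smoothR_congr f h x : {near x, f =1 h} -> smoothR f x -> smoothR h x.
Proof. exact: smooth_fun_congr. Qed.

Lemma derR_congr X f h x : {near x, f =1 h} -> derR X f x = derR X h x.
Proof. exact: tdiff_congr. Qed.

Lemma smoothR_near f x : smoothR f x -> \forall y \near x, smoothR f y.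
Proof.
move=> /smooth_at_near /(near_crd (dom_center x)).
apply: filterS2 (near_dom (dom_center x)) => y xy sf.
exact/(smooth_fun_chart f xy).
Qed.

Lemma smoothR_cst (a : R) x : smoothR (fun _ => a) x.
Proof. exact: smooth_at_cst. Qed.

Lemma smoothR_add f h x : smoothR f x -> smoothR h x ->
  smoothR (fun y => f y + h y) x.
Proof. exact: smooth_at_add. Qed.

Lemma smoothR_mul f h x : smoothR f x -> smoothR h x ->
  smoothR (fun y => f y * h y) x.
Proof. exact: smooth_at_mul. Qed.

Lemma smoothR_opp f x : smoothR f x -> smoothR (fun y => - f y) x.
Proof.
move=> sf; apply: smoothR_congr (smoothR_mul (smoothR_cst (-1) x) sf).
by apply: nearW => y; rewrite mulN1r.
Qed.

Lemma smoothR_sub f h x : smoothR f x -> smoothR h x ->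
  smoothR (fun y => f y - h y) x.
Proof. by move=> sf sh; apply: smoothR_add => //; exact: smoothR_opp. Qed.

Lemma smoothR_sum m (f : 'I_m -> M -> R) x :
  (forall i, smoothR (f i) x) -> smoothR (fun y => \sum_i f i y) x.
Proof. exact: smooth_at_sum. Qed.

Lemma smooth_crd b y : dom M b y -> smooth_fun (crd b) y.
Proof. by move=> bY; apply: crd_compat => //; exact: dom_center. Qed.

Lemma smoothR_crd b y i : dom M b y -> smoothR (fun z => crd b z 0 i) y.
Proof. by move=> /smooth_crd/smoothR_coords; exact. Qed.

Section tdiff.
Context {W : normedModType R}.
Implicit Types k l : M -> W.

Lemma smooth_fun_diff k x : smooth_fun k x -> differentiable (k \o crdV x) (crd x x).
Proof. exact: smooth_at_differentiable. Qed.

Lemma tdiff_linear k x (a : R) u v : smooth_fun k x ->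
  tdiff k x (a *: u + v) = a *: tdiff k x u + tdiff k x v.
Proof.
move=> /smooth_fun_diff dk; rewrite /tdiff !deriveE// linearD.
by congr (_ + _); exact: linearZ.
Qed.

Lemma tdiff0 k x : tdiff k x 0 = 0.
Proof. exact: derive0. Qed.

(** The chain rule for a change of chart: components of a tangent vector at [y] in
    the chart at [b] are its image under [tdiff (crd b) y]. *)
Lemma tdiff_chart k b y v : dom M b y ->
  differentiable (k \o crdV b) (crd b y) ->
  tdiff k y v = 'D_(tdiff (crd b) y v) (k \o crdV b) (crd b y).
Proof.
move=> bY dk; have yy := dom_center y.
have dt : differentiable (crd b \o crdV y) (crd y y).
  by apply: smooth_at_differentiable; exact: crd_compat.
have dk' : differentiable (k \o crdV b) ((crd b \o crdV y) (crd y y)).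
  by rewrite /= crdK.
transitivity ('D_v ((k \o crdV b) \o (crd b \o crdV y)) (crd y y)).
  by symmetry; exact: near_eq_derive (chart_change k bY yy).
rewrite (deriveE _ (differentiable_comp dt dk')) (diff_comp dt dk') /=.
by rewrite /tdiff -(deriveE v dt) (crdK yy) (deriveE _ dk).
Qed.

End tdiff.

Lemma diffR_cst (a : R) x v : diffR (fun _ => a) x v = 0.
Proof. exact: derive_cst. Qed.

Lemma diffRD f h x v : smoothR f x -> smoothR h x ->
  diffR (fun y => f y + h y) x v = diffR f x v + diffR h x v.
Proof.
move=> /smooth_fun_diff/diff_derivable dk /smooth_fun_diff/diff_derivable dl.
exact: (deriveD (dk v) (dl v)).
Qed.

Lemma diffRM f h x v : smoothR f x -> smoothR h x ->
  diffR (fun y => f y * h y) x v = f x * diffR h x v + h x * diffR f x v.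
Proof.
move=> /smooth_fun_diff/diff_derivable df /smooth_fun_diff/diff_derivable dh.
by have := deriveM (df v) (dh v); rewrite /= (crdK (dom_center x)).
Qed.

Lemma derR_comb f X Y h x : smoothR h x ->
  derR (fun y => f y *: X y + Y y) h x = f x * derR X h x + derR Y h x.
Proof. exact: tdiff_linear. Qed.

Lemma derR0 X h x : X x = 0 -> derR X h x = 0.
Proof. by rewrite /derR /vderive => ->; exact: tdiff0. Qed.

Lemma derR_cst X (a : R) x : derR X (fun _ => a) x = 0.
Proof. exact: diffR_cst. Qed.

Lemma derRD X f h x : smoothR f x -> smoothR h x ->
  derR X (fun y => f y + h y) x = derR X f x + derR X h x.
Proof. exact: diffRD. Qed.

Lemma derRM X f h x : smoothR f x -> smoothR h x ->
  derR X (fun y => f y * h y) x = f x * derR X h x + h x * derR X f x.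
Proof. exact: diffRM. Qed.

Lemma derR_sum X m (k : 'I_m -> M -> R) x : (forall i, smoothR (k i) x) ->
  derR X (fun y => \sum_i k i y) x = \sum_i derR X (k i) x.
Proof.
elim: m k => [|m IH] k sk.
  rewrite big_ord0 -(@derR_congr X (fun _ => 0)) ?derR_cst//.
  by apply: nearW => y; rewrite big_ord0.
rewrite big_ord_recr /= -(IH (fun i => k (widen_ord (leqnSn m) i)))//.
rewrite -derRD//; last exact: smoothR_sum.
by apply: derR_congr; apply: nearW => y; rewrite big_ord_recr.
Qed.

Lemma tdiff_coord {m} (k : M -> 'rV[R]_m) x v i : smooth_fun k x ->
  diffR (fun y => k y 0 i) x v = tdiff k x v 0 i.
Proof. by move=> /smooth_fun_diff dk; exact: (derive_coord 0 i v dk). Qed.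

Lemma tdiff_crd x v : tdiff (crd x) x v = v.
Proof.
rewrite -[RHS](derive_id (crd x x)).
by apply: near_eq_derive; exact: crdVK_near (dom_center x).
Qed.

Definition chart_partial b i f : M -> R :=
  fun y => 'D_(delta_mx 0 i) (f \o crdV b : 'rV[R]_n -> R^o) (crd b y).

Definition field_coord b X i : M -> R := fun y => vderive X (crd b) y 0 i.

Lemma field_coordE b X i y : dom M b y -> field_coord b X i y = derR X (fun z => crd b z 0 i) y.
Proof. by move=> bY; symmetry; exact: tdiff_coord (smooth_crd bY). Qed.

Lemma derR_chart X f b y : dom M b y -> smoothR f y ->
  derR X f y = \sum_i field_coord b X i y * chart_partial b i f y.
Proof.
move=> bY /(smooth_fun_chart f bY)/smooth_at_differentiable df.
rewrite /derR /vderive (tdiff_chart _ bY df) (deriveE _ df).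
rewrite [X in 'd _ _ X]row_sum_delta linear_sum; apply: eq_bigr => i _.
by rewrite linearZ /chart_partial (deriveE _ df).
Qed.

Lemma chart_partial_crdV b i f y : dom M b y ->
  {near crd b y, chart_partial b i f \o crdV b =1
    'D_(delta_mx 0 i) (f \o crdV b : 'rV[R]_n -> R^o)}.
Proof. by move=> /crdVK_near; apply: filterS => u; rewrite /chart_partial /= => ->. Qed.

Lemma smooth_chart_partial b i f y : dom M b y -> smoothR f y -> smoothR (chart_partial b i f) y.
Proof.
move=> bY /(smooth_fun_chart f bY) sf; apply/(smooth_fun_chart _ bY).
have := smooth_at_derive (delta_mx 0 i) sf; apply: smooth_at_congr.
by have := chart_partial_crdV i f bY; apply: filterS => u ->.
Qed.

Lemma chart_partial_swap b i j f y : dom M b y -> smoothR f y ->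
  chart_partial b j (chart_partial b i f) y = chart_partial b i (chart_partial b j f) y.
Proof.
move=> bY /(smooth_fun_chart f bY) sf; rewrite {1 3}/chart_partial.
transitivity ('D_(delta_mx 0 j) ('D_(delta_mx 0 i)
  (f \o crdV b : 'rV[R]_n -> R^o)) (crd b y)).
  exact: near_eq_derive (chart_partial_crdV i f bY).
rewrite (derive_swap _ _ sf).
by symmetry; exact: near_eq_derive (chart_partial_crdV j f bY).
Qed.

Lemma near_derR_chart X f b x : dom M b x -> smoothR f x ->
  {near x, (fun y => \sum_i field_coord b X i y * chart_partial b i f y) =1 derR X f}.
Proof.
move=> bx sf; apply: filterS2 (near_dom bx) (smoothR_near sf) => y bY sy.
by rewrite -derR_chart.
Qed.

(** One chart suffices, since in another one the components are obtained by
    multiplying with partial derivatives of the transition map. *)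
Lemma smooth_field_chart X b x : dom M b x ->
  smooth_field X x <-> forall i, smoothR (field_coord b X i) x.
Proof.
move=> bx; split=> [sX|sX z zx]; first by apply/smoothR_coords; exact: sX.
apply/smoothR_coords => j.
have : smoothR (fun y => \sum_i
    field_coord b X i y * chart_partial b i (fun z' => crd z z' 0 j) y) x.
  apply: smoothR_sum => i; apply: smoothR_mul => //.
  by apply: smooth_chart_partial => //; exact: smoothR_crd.
apply: smoothR_congr.
have := near_derR_chart X bx (smoothR_crd j zx).
by apply: filterS2 (near_dom zx) => y zy ->; rewrite -field_coordE.
Qed.

Lemma smooth_field_near X x : smooth_field X x -> \forall y \near x, smooth_field X y.
Proof.
have xx := dom_center x; move=> /(smooth_field_chart X xx) sX.
have : \forall y \near x, forall i, smoothR (field_coord x X i) y.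
  by apply: filter_forall => i; exact: smoothR_near.
by apply: filterS2 (near_dom xx) => y xy sy; apply/(smooth_field_chart X xy).
Qed.

Lemma smooth_derR X f x : smooth_field X x -> smoothR f x -> smoothR (derR X f) x.
Proof.
have xx := dom_center x; move=> /(smooth_field_chart X xx) sX sf.
apply: smoothR_congr (near_derR_chart X xx sf) _.
by apply: smoothR_sum => i; apply: smoothR_mul => //; exact: smooth_chart_partial.
Qed.

Lemma smooth_field_congr X Y x :
  {near x, X =1 Y} -> smooth_field X x -> smooth_field Y x.
Proof.
move=> XY sX z zx; apply: smooth_fun_congr (sX z zx).
by apply: filterS XY => y XYy; rewrite /vderive XYy.
Qed.

Lemma smooth_field_comb f X Y x : smoothR f x ->
  smooth_field X x -> smooth_field Y x -> smooth_field (fun y => f y *: X y + Y y) x.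
Proof.
have xx := dom_center x.
move=> sf /(smooth_field_chart X xx) sX /(smooth_field_chart Y xx) sY.
apply/(smooth_field_chart _ xx) => i.
apply: smoothR_congr (smoothR_add (smoothR_mul sf (sX i)) (sY i)).
apply: filterS (near_dom xx) => y xy.
by rewrite /field_coord /vderive tdiff_linear ?mxE//; exact: smooth_crd.
Qed.

Lemma smooth_field0 x : smooth_field (fun _ => 0 : 'rV[R]_n) x.
Proof.
have xx := dom_center x; apply/(smooth_field_chart _ xx) => i.
apply: smoothR_congr (smoothR_cst 0 x).
by apply: nearW => y; rewrite /field_coord /vderive tdiff0 mxE.
Qed.

Lemma smooth_field_scale f X x : smoothR f x ->
  smooth_field X x -> smooth_field (fun y => f y *: X y) x.
Proof.
move=> sf sX; apply: smooth_field_congr (smooth_field_comb sf sX (@smooth_field0 x)).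
by apply: nearW => y; rewrite addr0.
Qed.

Lemma smooth_field_add X Y x :
  smooth_field X x -> smooth_field Y x -> smooth_field (fun y => X y + Y y) x.
Proof.
move=> sX sY; apply: smooth_field_congr (smooth_field_comb (smoothR_cst 1 x) sX sY).
by apply: nearW => y; rewrite scale1r.
Qed.

Lemma smooth_field_opp X x : smooth_field X x -> smooth_field (fun y => - X y) x.
Proof.
move=> sX; apply: smooth_field_congr (smooth_field_scale (smoothR_cst (-1) x) sX).
by apply: nearW => y; rewrite scaleN1r.
Qed.

Lemma smooth_field_sum m (X : 'I_m -> field M) x :
  (forall i, smooth_field (X i) x) -> smooth_field (fun y => \sum_i X i y) x.
Proof.
elim: m X => [|m IH] X sX.
  by apply: smooth_field_congr (@smooth_field0 x); apply: nearW => y; rewrite big_ord0.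
apply: smooth_field_congr (smooth_field_add
  (IH _ (fun i => sX (widen_ord (leqnSn m) i))) (sX ord_max)).
by apply: nearW => y; rewrite big_ord_recr.
Qed.

(** The definition of [lie] reads both fields in the chart at the point of
    evaluation, which hides that the bracket is the commutator of derivations;
    the second derivatives of [f] cancel by their symmetry. *)
Lemma diffR_lie X Y f x : smooth_field X x -> smooth_field Y x -> smoothR f x ->
  diffR f x (lie X Y x) = derR X (derR Y f) x - derR Y (derR X f) x.
Proof.
have xx := dom_center x; move=> sX sY sf.
have second X' Y' : smooth_field X' x -> smooth_field Y' x ->
  derR X' (derR Y' f) x =
    \sum_i derR X' (field_coord x Y' i) x * chart_partial x i f x
    + \sum_i \sum_j field_coord x Y' i x *
        (field_coord x X' j x * chart_partial x j (chart_partial x i f) x).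
  move=> sX' sY'; rewrite -(derR_congr _ (near_derR_chart Y' xx sf)).
  have sY'i i : smoothR (field_coord x Y' i) x.
    by move/(smooth_field_chart _ xx): sY'; exact.
  rewrite derR_sum => [|i]; last by apply: smoothR_mul => //; exact: smooth_chart_partial.
  rewrite -big_split; apply: eq_bigr => i _ /=.
  rewrite derRM//; last exact: smooth_chart_partial.
  rewrite [LHS]addrC; congr (_ + _); first exact: mulrC.
  by rewrite -mulr_sumr -derR_chart//; exact: smooth_chart_partial.
rewrite -[LHS]/(derR (lie X Y) f x) (derR_chart (lie X Y) xx sf).
rewrite (second X Y)// (second Y X)//.
rewrite (commutator_sum (fun i => derR X (field_coord x Y i) x)
  (fun i => derR Y (field_coord x X i) x) (field_coord x X ^~ x) (field_coord x Y ^~ x)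
  (fun i => chart_partial x i f x) (fun i j => chart_partial_swap i j xx sf)).
apply: eq_bigr => i _; congr (_ * _).
have h1 := tdiff_coord (X x) i (sY x xx); have h2 := tdiff_coord (Y x) i (sX x xx).
rewrite /field_coord {1}/vderive tdiff_crd /lie !mxE.
exact: (esym (f_equal2 (fun c d : R => c - d) h1 h2)).
Qed.

Lemma lieC X Y x : lie X Y x = - lie Y X x.
Proof. by rewrite /lie opprB. Qed.

(** The tangent space at [y] is read in the chart at [y] and not in the one at
    [b], hence the transition map. *)
Definition coord_field b i : field M :=
  fun y => 'D_(delta_mx 0 i) (crd y \o crdV b) (crd b y).

Lemma transition_diff b y z : dom M b z -> dom M y z ->
  differentiable (crd y \o crdV b) (crd b z).
Proof. by move=> bz yz; apply: smooth_at_differentiable; exact: crd_compat. Qed.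

Lemma coord_field_expand b y v : dom M b y ->
  v = \sum_i tdiff (crd b) y v 0 i *: coord_field b i y.
Proof.
move=> bY; have dt := transition_diff bY (dom_center y).
transitivity ('D_(tdiff (crd b) y v) (crd y \o crdV b) (crd b y)).
  by rewrite -tdiff_chart ?tdiff_crd.
rewrite (deriveE _ dt) [X in 'd _ _ X]row_sum_delta linear_sum.
by apply: eq_bigr => i _; rewrite linearZ /coord_field (deriveE _ dt).
Qed.

Lemma tdiff_coord_field b i y : dom M b y -> tdiff (crd b) y (coord_field b i y) = delta_mx 0 i.
Proof.
move=> bY; have yy := dom_center y; have dt := transition_diff bY yy.
have dt2 : differentiable (crd b \o crdV y) (crd y y) by exact: transition_diff.
have yE : (crd y \o crdV b) (crd b y) = crd y y by rewrite /= crdK.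
have dt' : differentiable (crd b \o crdV y) ((crd y \o crdV b) (crd b y)).
  by rewrite yE.
transitivity ('D_(delta_mx 0 i) ((crd b \o crdV y) \o (crd y \o crdV b)) (crd b y)).
  rewrite (deriveE _ (differentiable_comp dt dt')) (diff_comp dt dt') /=.
  by rewrite (crdK bY) /tdiff (deriveE _ dt2) /coord_field (deriveE _ dt).
rewrite -[RHS](derive_id (crd b y)).
transitivity ('D_(delta_mx 0 i) (crd b \o crdV b) (crd b y)).
  exact: near_eq_derive (chart_change (crd b) yy bY).
by apply: near_eq_derive; exact: crdVK_near.
Qed.

Lemma smooth_coord_field b i y : dom M b y -> smooth_field (coord_field b i) y.
Proof.
move=> bY; apply/(smooth_field_chart _ bY) => j.
apply: smoothR_congr (smoothR_cst ((delta_mx 0 i : 'rV[R]_n) 0 j) y).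
by apply: filterS (near_dom bY) => z bz; rewrite /field_coord /vderive tdiff_coord_field.
Qed.

End ManifoldCalculus.

(** * Smooth maps *)

Section SmoothMaps.
Context {R : realType} {m n : nat} {M : manifold R m} {N : manifold R n}.
Context (p : M -> N).
Implicit Types (x y : M) (X Y Z : field M) (f : N -> R).

Lemma smooth_map_near x (P : N -> Prop) : smooth_map p x ->
  (\forall z \near p x, P z) -> \forall y \near x, P (p y).
Proof. by move=> [cp _]; exact: cp. Qed.

Lemma near_chart_map {W : normedModType R} (f : N -> W) x : smooth_map p x ->
  {near crd x x, (f \o crdV (p x)) \o (crd (p x) \o p \o crdV x) =1 (f \o p) \o crdV x}.
Proof.
move=> sp; have := smooth_map_near sp (near_dom (dom_center (p x))).
move=> /(near_crdV (dom_center x)); apply: filterS => u pu /=.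
by rewrite crdK.
Qed.

Lemma smoothR_map f x : smooth_map p x -> smoothR f (p x) -> smoothR (f \o p) x.
Proof.
move=> sp sf; apply: smooth_at_congr (near_chart_map f sp) _.
apply: smooth_at_comp; first by case: sp.
by rewrite /= (crdK (dom_center x)).
Qed.

Lemma tdiff_map {W : normedModType R} (f : N -> W) x v : smooth_map p x ->
  smooth_fun f (p x) -> tdiff (f \o p) x v = tdiff f (p x) (push p x v).
Proof.
move=> sp /smooth_fun_diff df.
have dp : differentiable (crd (p x) \o p \o crdV x) (crd x x).
  by apply: smooth_at_differentiable; case: sp.
have df' : differentiable (f \o crdV (p x)) ((crd (p x) \o p \o crdV x) (crd x x)).
  by rewrite /= (crdK (dom_center x)).
transitivity ('D_v ((f \o crdV (p x)) \o (crd (p x) \o p \o crdV x)) (crd x x)).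
  by symmetry; exact: near_eq_derive (near_chart_map f sp).
rewrite (deriveE _ (differentiable_comp dp df')) (diff_comp dp df') /=.
by rewrite (crdK (dom_center x)) /push /tdiff (deriveE _ dp) (deriveE _ df).
Qed.

Lemma push_linear x (a : R) u v : smooth_map p x ->
  push p x (a *: u + v) = a *: push p x u + push p x v.
Proof. by move=> [_ sp]; exact: tdiff_linear. Qed.

Lemma derR_map X (X' : field N) f x : smooth_map p x -> smoothR f (p x) ->
  push p x (X x) = X' (p x) -> derR X (f \o p) x = derR X' f (p x).
Proof.
move=> sp sf XX'; rewrite [RHS](_ : _ = diffR f (p x) (push p x (X x))).
  exact: tdiff_map.
by rewrite XX'.
Qed.

(** The push-forward of a field is not a field on the target, but only a field along
    [p].  Its smoothness is expressed by that of its components with respect to the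
    coordinate fields around [p x]. *)
Lemma push_expand X x : smooth_map p x -> smooth_field X x -> (forall y, smooth_map p y) ->
  exists c : 'I_n -> M -> R, (forall i, smoothR (c i) x) /\
    \forall y \near x, push p y (X y) = \sum_i c i y *: coord_field (p x) i (p y).
Proof.
move=> sp sX ssp; exists (fun i => derR X ((fun z => crd (p x) z 0 i) \o p)); split.
  move=> i; apply: smooth_derR => //; apply: smoothR_map => //.
  exact: smoothR_crd (dom_center _).
have := smooth_map_near sp (near_dom (dom_center (p x))).
apply: filterS => y xy; rewrite {1}(coord_field_expand (push p y (X y)) xy).
apply: eq_bigr => i _; congr (_ *: _).
have sc := smooth_crd xy.
by rewrite -(tdiff_coord _ _ sc); symmetry; apply: tdiff_map => //; exact: smoothR_crd.
Qed.

End SmoothMaps.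

(** * Forms and connections *)

Section Tensors.
Context {R : realType} {n : nat} {M : manifold R n}.
Implicit Types (x y : M) (X Y Z : field M) (f : M -> R) (g h : form2 M).

Section forms.
Context (h : form2 M) (sh : sym_tensor h).

Lemma sform_linl x c u v w : h x (c *: u + v) w = c * h x u w + h x v w.
Proof. by case: sh. Qed.

Lemma sform_sym x u v : h x u v = h x v u.
Proof. by case: sh. Qed.

Lemma sform_linr x c u v w : h x w (c *: u + v) = c * h x w u + h x w v.
Proof. by rewrite sform_sym sform_linl ![h x w _]sform_sym. Qed.

Lemma sform0l x w : h x 0 w = 0.
Proof.
have := sform_linl x 1 0 0 w; rewrite scaler0 addr0 mul1r => /eqP.
by rewrite -subr_eq subrr eq_sym => /eqP.
Qed.

Lemma sform0r x w : h x w 0 = 0.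
Proof. by rewrite sform_sym sform0l. Qed.

Lemma sformDl x u v w : h x (u + v) w = h x u w + h x v w.
Proof. by have := sform_linl x 1 u v w; rewrite scale1r mul1r. Qed.

Lemma sformZl x c u w : h x (c *: u) w = c * h x u w.
Proof. by have := sform_linl x c u 0 w; rewrite sform0l !addr0. Qed.

Lemma sformNl x u w : h x (- u) w = - h x u w.
Proof. by rewrite -scaleN1r sformZl mulN1r. Qed.

Lemma sformZr x c u w : h x w (c *: u) = c * h x w u.
Proof. by rewrite sform_sym sformZl ![h x w _]sform_sym. Qed.

Lemma sformNr x u w : h x w (- u) = - h x w u.
Proof. by rewrite sform_sym sformNl ![h x w _]sform_sym. Qed.

Lemma sform_suml x k (u : 'I_k -> 'rV[R]_n) w : h x (\sum_i u i) w = \sum_i h x (u i) w.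
Proof.
elim: k u => [|k IH] u; first by rewrite !big_ord0 sform0l.
by rewrite !big_ord_recr sformDl IH.
Qed.

Lemma sform_sumr x k (u : 'I_k -> 'rV[R]_n) w : h x w (\sum_i u i) = \sum_i h x w (u i).
Proof. by rewrite sform_sym sform_suml; apply: eq_bigr => i _; rewrite sform_sym. Qed.

Lemma sform_smooth x X Y : smooth_field X x -> smooth_field Y x ->
  smoothR (fun y => h y (X y) (Y y)) x.
Proof. by case: sh => _ _ H sX sY; exact: H. Qed.

End forms.

Lemma sym_tensorI h :
  (forall x (c : R) u v w, h x (c *: u + v) w = c * h x u w + h x v w) ->
  (forall x u v, h x u v = h x v u) ->
  (forall x X Y, smooth_field X x -> smooth_field Y x ->
    smoothR (fun y => h y (X y) (Y y)) x) -> sym_tensor h.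
Proof. by move=> hl hs hsm; split=> // x X Y sX sY; exact: hsm. Qed.

Lemma form1_smooth (a : form1 M) x X : smooth_form1 a -> smooth_field X x ->
  smoothR (fun y => a y (X y)) x.
Proof. by case=> _ H sX; exact: H. Qed.

Lemma ext_diff1E (a : form1 M) X Y x : ext_diff1 a X Y x =
  derR X (fun y => a y (Y y)) x - derR Y (fun y => a y (X y)) x - a x (lie X Y x).
Proof. by []. Qed.

Section levi_civita.
Context (g : form2 M) (D : field M -> field M -> field M) (lc : levi_civita g D).

Lemma nabla_smooth x X Y : smooth_field X x -> smooth_field Y x -> smooth_field (D X Y) x.
Proof. by move=> sX sY; exact: (conn_smooth (lc_connection lc)). Qed.

(** The two connection rules are stated for combinations [f X + Y], the shape in
    which linearity over functions is used throughout. *)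
Lemma nabla_combl x f X X' Y : smoothR f x ->
  smooth_field X x -> smooth_field X' x -> smooth_field Y x ->
  D (fun y => f y *: X y + X' y) Y x = f x *: D X Y x + D X' Y x.
Proof.
move=> sf sX sX' sY.
rewrite (conn_addl (lc_connection lc) (smooth_field_scale sf sX) sX' sY).
by rewrite (conn_scalel (lc_connection lc) sf sX sY).
Qed.

Lemma nabla_combr x f X Y Y' : smoothR f x ->
  smooth_field X x -> smooth_field Y x -> smooth_field Y' x ->
  D X (fun y => f y *: Y y + Y' y) x = derR X f x *: Y x + f x *: D X Y x + D X Y' x.
Proof.
move=> sf sX sY sY'.
rewrite (conn_addr (lc_connection lc) sX (smooth_field_scale sf sY) sY').
by rewrite (conn_leibniz (lc_connection lc) sf sX sY).
Qed.

Lemma nabla_metric x X Y Z : smooth_field X x -> smooth_field Y x -> smooth_field Z x ->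
  derR X (fun y => g y (Y y) (Z y)) x = g x (D X Y x) (Z x) + g x (Y x) (D X Z x).
Proof. by move=> sX sY sZ; exact: (lc_metric lc sX sY sZ). Qed.

Lemma nabla_torsion x X Y : smooth_field X x -> smooth_field Y x ->
  lie X Y x = D X Y x - D Y X x.
Proof. by move=> sX sY; rewrite (lc_torsion_free lc sX sY). Qed.

End levi_civita.

Lemma cov_diffE D X (S : ftensor M) Y Z x :
  cov_diff D X S Y Z x = derR X (S Y Z) x - S (D X Y) Z x - S Y (D X Z) x.
Proof. by []. Qed.

Lemma sym_tensor_smooth h x X Y : sym_tensor h ->
  smooth_field X x -> smooth_field Y x -> smoothR (on_fields h X Y) x.
Proof. by move=> sh sX sY; exact: (sform_smooth sh sX sY). Qed.

End Tensors.

(* From here on smoothness and derivatives enter only through the rules above, and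
   never as limits of difference quotients. *)
Opaque smoothR derR diffR smooth_field lie.

(** * Tensorial functionals and frames *)

Section Tensorial.
Context {R : realType} {n : nat} {M : manifold R n}.
Implicit Types (x y : M) (X Y Z : field M) (f : M -> R) (g h : form2 M).

Definition tensorial x (T : field M -> R) := forall f X Y,
  smoothR f x -> smooth_field X x -> smooth_field Y x ->
  T (fun y => f y *: X y + Y y) = f x * T X + T Y.

Definition bitensorial x (A : field M -> field M -> R) :=
  (forall Y, smooth_field Y x -> tensorial x (A^~ Y)) /\
  (forall X, smooth_field X x -> tensorial x (A X)).

Section functional.
Context (x : M) (T : field M -> R) (tT : tensorial x T).

Lemma tensorial0 : T (fun _ => 0) = 0.
Proof.
have s0 := @smooth_field0 R n M x.
have := tT (smoothR_cst 1 x) s0 s0.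
rewrite (_ : (fun y => _) = fun=> 0); last by apply/funext => y; rewrite scaler0 addr0.
by rewrite mul1r => /eqP; rewrite -subr_eq subrr eq_sym => /eqP.
Qed.

Lemma tensorialZ f X : smoothR f x -> smooth_field X x ->
  T (fun y => f y *: X y) = f x * T X.
Proof.
move=> sf sX; have := tT sf sX (@smooth_field0 R n M x).
rewrite tensorial0 addr0 => <-.
by congr T; apply/funext => y; rewrite addr0.
Qed.

Lemma tensorialN X : smooth_field X x -> T (fun y => - X y) = - T X.
Proof.
move=> sX; rewrite -mulN1r -(tensorialZ (smoothR_cst (-1) x) sX).
by congr T; apply/funext => y; rewrite scaleN1r.
Qed.

Definition indicator_eq X Y : M -> R := fun y => if X y == Y y then 1 else 0.

Lemma near_indicator_eq X Y : {near x, X =1 Y} ->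
  {near x, (fun _ => 1) =1 indicator_eq X Y}.
Proof. by apply: filterS => y XY; rewrite /indicator_eq XY eqxx. Qed.

Lemma smooth_indicator_eq X Y : {near x, X =1 Y} -> smoothR (indicator_eq X Y) x.
Proof. by move=> /near_indicator_eq XY; exact: smoothR_congr XY (smoothR_cst 1 x). Qed.

Lemma indicator_eq_scale X Y :
  (fun y => indicator_eq X Y y *: X y) = (fun y => indicator_eq X Y y *: Y y).
Proof.
by apply/funext => y; rewrite /indicator_eq; case: eqP => [->//|_]; rewrite !scale0r.
Qed.

(** The function that is [1] where [X] and [Y] agree and [0] elsewhere is smooth
    at [x], being constant around it, and multiplied with it [X] and [Y] become
    the same field.  So linearity over functions gives locality at once. *)
Lemma tensorial_congr X Y : {near x, X =1 Y} -> smooth_field X x -> T X = T Y.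
Proof.
move=> XY sX; have sY := smooth_field_congr XY sX.
have sf := smooth_indicator_eq XY.
have := tensorialZ sf sX; rewrite indicator_eq_scale (tensorialZ sf sY).
by rewrite -(nbhs_singleton (near_indicator_eq XY)) !mul1r => ->.
Qed.

Lemma tensorial_sum k (c : 'I_k -> M -> R) (X : 'I_k -> field M) :
  (forall i, smoothR (c i) x) -> (forall i, smooth_field (X i) x) ->
  T (fun y => \sum_i c i y *: X i y) = \sum_i c i x * T (X i).
Proof.
elim: k c X => [|k IH] c X sc sX.
  rewrite big_ord0 -[RHS]tensorial0; congr T; apply/funext => y.
  by rewrite big_ord0.
pose w := widen_ord (leqnSn k).
rewrite big_ord_recr /= -(IH (fun i => c (w i)) (fun i => X (w i)))// addrC -tT//.
  congr T; apply/funext => y; rewrite big_ord_recr /=; exact: addrC.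
by apply: smooth_field_sum => i; exact: smooth_field_scale.
Qed.

End functional.

Lemma tensorialB x (T1 T2 : field M -> R) : tensorial x T1 -> tensorial x T2 ->
  tensorial x (fun X => T1 X - T2 X).
Proof. by move=> t1 t2 f X Y sf sX sY; rewrite t1// t2//; ring. Qed.

Lemma tensorial_opp x (T : field M -> R) : tensorial x T -> tensorial x (fun X => - T X).
Proof. by move=> t f X Y sf sX sY; rewrite t//; ring. Qed.

Lemma tensorialMl x (T : field M -> R) a : tensorial x T -> tensorial x (fun X => a * T X).
Proof. by move=> t f X Y sf sX sY; rewrite t//; ring. Qed.

Lemma tensorialMr x (T : field M -> R) a : tensorial x T -> tensorial x (fun X => T X * a).
Proof. by move=> t f X Y sf sX sY; rewrite t//; ring. Qed.

Lemma tensorial_big x k (T : 'I_k -> field M -> R) : (forall i, tensorial x (T i)) ->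
  tensorial x (fun X => \sum_i T i X).
Proof.
move=> t f X Y sf sX sY; rewrite mulr_sumr -big_split; apply: eq_bigr => i _.
exact: t.
Qed.

Lemma frame_near g E x : orthonormal_frame g E x ->
  \forall y \near x, orthonormal_frame g E y.
Proof.
move=> [sE oE]; have : \forall y \near x, forall i, smooth_field (E i) y.
  by apply: filter_forall => i; exact: smooth_field_near.
by apply: filterS2 (near_join oE) => y oEy sEy.
Qed.

Section frames.
Context (g : form2 M) (sg : sym_tensor g).
Context (E : 'I_n -> field M) (x : M) (onE : orthonormal_frame g E x).

Lemma frame_smooth i : smooth_field (E i) x.
Proof. by case: onE. Qed.

Lemma frameE i j : g x (E i x) (E j x) = (i == j)%:R.
Proof. by case: onE => _ /nbhs_singleton. Qed.

(** The Gram matrix is the identity, so the [n] vectors are independent and thus a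
    basis, and the coefficients are read off by pairing with them. *)
Lemma frame_expand v : v = \sum_i g x v (E i x) *: E i x.
Proof.
pose A : 'M[R]_n := \matrix_i E i x.
have AE (c : 'rV[R]_n) : c *m A = \sum_i c 0 i *: E i x.
  by rewrite mulmx_sum_row; apply: eq_bigr => i _; rewrite rowK.
have gA (c : 'rV[R]_n) j : g x (c *m A) (E j x) = c 0 j.
  rewrite AE (sform_suml sg) (bigD1 j)//= (sformZl sg) frameE eqxx mulr1.
  rewrite big1 ?addr0// => i /negbTE ij.
  by rewrite (sformZl sg) frameE ij mulr0.
have freeA : row_free A.
  rewrite -kermx_eq0; apply/eqP/row_matrixP => i; rewrite row0.
  apply/rowP => j; rewrite -gA -row_mul mulmx_ker row0 (sform0l sg).
  by rewrite mxE.
have /submxP[c ->] : (v <= A)%MS by rewrite submx_full// row_full_unit -row_free_unit.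
by rewrite {1}AE; apply: eq_bigr => i _; rewrite gA.
Qed.

Lemma frame_inner u v : g x u v = \sum_i g x u (E i x) * g x v (E i x).
Proof.
rewrite {1}(frame_expand u) (sform_suml sg); apply: eq_bigr => i _.
by rewrite (sformZl sg) (sform_sym sg x v).
Qed.

End frames.

Lemma near_frame_expand g E x X : sym_tensor g -> orthonormal_frame g E x ->
  {near x, X =1 fun y => \sum_i g y (X y) (E i y) *: E i y}.
Proof.
by move=> sg /frame_near; apply: filterS => y onE; exact: frame_expand.
Qed.

Section trace.
Context (g : form2 M) (sg : sym_tensor g) (x : M).
Context (E : 'I_n -> field M) (onE : orthonormal_frame g E x).

(** By locality the field may be replaced by its expansion in the frame, so only its
    value at [x] matters. *)
Lemma tensorial_frame T X : tensorial x T -> smooth_field X x ->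
  T X = \sum_i g x (X x) (E i x) * T (E i).
Proof.
move=> tT sX; rewrite (tensorial_congr tT (near_frame_expand X sg onE) sX).
apply: (tensorial_sum tT (c := fun i y => g y (X y) (E i y)) (X := E)) => i.
  exact: (sform_smooth sg sX (frame_smooth onE i)).
exact: (frame_smooth onE).
Qed.

End trace.

(** The change of basis between two orthonormal frames is an orthogonal matrix. *)
Lemma trace_frame g x E E' (A : field M -> field M -> R) : sym_tensor g ->
  orthonormal_frame g E x -> orthonormal_frame g E' x -> bitensorial x A ->
  \sum_i A (E i) (E i) = \sum_i A (E' i) (E' i).
Proof.
move=> sg onE onE' [tAl tAr]; have sE := frame_smooth onE.
have sE' := frame_smooth onE'.
have AE i : A (E i) (E i) = \sum_l \sum_m
    g x (E' l x) (E i x) * g x (E' m x) (E i x) * A (E' l) (E' m).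
  rewrite (tensorial_frame sg onE' (tAl _ (sE i)) (sE i)).
  apply: eq_bigr => l _.
  rewrite (tensorial_frame sg onE' (tAr _ (sE' l)) (sE i)) mulr_sumr.
  apply: eq_bigr => k _.
  by rewrite mulrA (sform_sym sg x (E i x)) (sform_sym sg x (E i x) (E' k x)).
rewrite (eq_bigr _ (fun i _ => AE i)) exchange_big; apply: eq_bigr => l _ /=.
rewrite exchange_big (bigD1 l)//= -mulr_suml -(frame_inner sg onE) frameE//.
rewrite eqxx mul1r big1 ?addr0// => k kl.
by rewrite -mulr_suml -(frame_inner sg onE) frameE// eq_sym (negbTE kl) mul0r.
Qed.

(** The frame is exchanged in one index at a time. *)
Lemma contract_frame g x E E' (A B : field M -> field M -> R) : sym_tensor g ->
  orthonormal_frame g E x -> orthonormal_frame g E' x ->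
  bitensorial x A -> bitensorial x B ->
  \sum_i \sum_j A (E i) (E j) * B (E i) (E j) =
  \sum_i \sum_j A (E' i) (E' j) * B (E' i) (E' j).
Proof.
move=> sg onE onE' [tAl tAr] [tBl tBr].
have sE := frame_smooth onE; have sE' := frame_smooth onE'.
transitivity (\sum_i \sum_j A (E i) (E' j) * B (E i) (E' j)).
  apply: eq_bigr => i _.
  apply: (@trace_frame g x E E' (fun Y Y' => A (E i) Y * B (E i) Y')) => //.
  by split=> Y sY; [exact: tensorialMr (tAr _ (sE i))|exact: tensorialMl (tBr _ (sE i))].
rewrite exchange_big [RHS]exchange_big; apply: eq_bigr => j _.
apply: (@trace_frame g x E E' (fun Y Y' => A Y (E' j) * B Y' (E' j))) => //.
by split=> Y sY; [exact: tensorialMr (tAl _ (sE' j))|exact: tensorialMl (tBl _ (sE' j))].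
Qed.

End Tensorial.

(** * Locality of connections *)

Section Covariant.
Context {R : realType} {n : nat} {M : manifold R n}.
Context (g : form2 M) (D : field M -> field M -> field M) (lc : levi_civita g D).
Implicit Types (x y : M) (X Y Z W : field M) (f : M -> R) (S : ftensor M).

Lemma nabla_tensorial x Y i : smooth_field Y x -> tensorial x (fun X => D X Y x 0 i).
Proof. by move=> sY f X X' sf sX sX'; rewrite (nabla_combl lc sf sX sX' sY) !mxE. Qed.

Lemma nabla_congrl x X X' Y : {near x, X =1 X'} ->
  smooth_field X x -> smooth_field Y x -> D X Y x = D X' Y x.
Proof.
by move=> XX' sX sY; apply/rowP => i; exact: (tensorial_congr (nabla_tensorial i sY) XX' sX).
Qed.

Lemma nabla0l x Y : smooth_field Y x -> D (fun _ => 0) Y x = 0.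
Proof.
by move=> sY; apply/rowP => i; rewrite mxE; exact: (tensorial0 (nabla_tensorial i sY)).
Qed.

Lemma nablaNl x X Y : smooth_field X x -> smooth_field Y x ->
  D (fun y => - X y) Y x = - D X Y x.
Proof.
by move=> sX sY; apply/rowP => i; rewrite mxE; exact: (tensorialN (nabla_tensorial i sY) sX).
Qed.

Lemma nabla0r x X : smooth_field X x -> D X (fun _ => 0) x = 0.
Proof.
move=> sX; have s0 := @smooth_field0 R n M x.
have E : (fun y : M => (1 : R) *: (0 : 'rV[R]_n) + 0) = fun=> 0.
  by apply/funext => y; rewrite scaler0 addr0.
have := nabla_combr lc (smoothR_cst 1 x) sX s0 s0; rewrite /= E.
rewrite scaler0 add0r scale1r => /eqP.
by rewrite -subr_eq subrr eq_sym => /eqP.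
Qed.

Lemma nablaZr x f X Y : smoothR f x -> smooth_field X x -> smooth_field Y x ->
  D X (fun y => f y *: Y y) x = derR X f x *: Y x + f x *: D X Y x.
Proof.
move=> sf sX sY; have := nabla_combr lc sf sX sY (@smooth_field0 R n M x).
rewrite (nabla0r sX) addr0 => <-; congr (D _ _ _); apply/funext => y.
by rewrite addr0.
Qed.

(** The same localising function as in [tensorial_congr]; the Leibniz term vanishes
    because that function is constant around [x]. *)
Lemma nabla_congrr x X Y Y' : {near x, Y =1 Y'} ->
  smooth_field X x -> smooth_field Y x -> D X Y x = D X Y' x.
Proof.
move=> YY' sX sY; have sY' := smooth_field_congr YY' sY.
have sf := smooth_indicator_eq YY'.
have f1 := near_indicator_eq YY'; have fx := nbhs_singleton f1.
have Df : derR X (indicator_eq Y Y') x = 0.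
  by rewrite -(derR_congr X f1) derR_cst.
have := nablaZr sf sX sY; rewrite indicator_eq_scale (nablaZr sf sX sY').
by rewrite Df -fx !scale0r !add0r !scale1r => ->.
Qed.

Lemma near_nabla_combl x f X X' Y : smoothR f x ->
  smooth_field X x -> smooth_field X' x -> smooth_field Y x ->
  {near x, D (fun y => f y *: X y + X' y) Y =1 fun y => f y *: D X Y y + D X' Y y}.
Proof.
move=> /smoothR_near sf /smooth_field_near sX /smooth_field_near sX' /smooth_field_near sY.
apply: filterS (filterI (filterI sf sX) (filterI sX' sY)) => y [[{}sf {}sX] [{}sX' {}sY]].
exact: (nabla_combl lc sf sX sX' sY).
Qed.

Lemma near_nabla_combr x f X Y Y' : smoothR f x ->
  smooth_field X x -> smooth_field Y x -> smooth_field Y' x ->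
  {near x, D X (fun y => f y *: Y y + Y' y) =1
    fun y => derR X f y *: Y y + (f y *: D X Y y + D X Y' y)}.
Proof.
move=> /smoothR_near sf /smooth_field_near sX /smooth_field_near sY /smooth_field_near sY'.
apply: filterS (filterI (filterI sf sX) (filterI sY sY')) => y [[{}sf {}sX] [{}sY {}sY']].
by rewrite addrA (nabla_combr lc sf sX sY sY').
Qed.

(** The chart in which [lie X Y] is computed changes from point to point, which makes
    a direct proof awkward; torsion-freeness expresses the bracket by the connection. *)
Lemma lie_smooth x X Y : smooth_field X x -> smooth_field Y x -> smooth_field (lie X Y) x.
Proof.
move=> sX sY; apply: (@smooth_field_congr _ _ _ (fun y => D X Y y - D Y X y)).
  apply: filterS2 (smooth_field_near sX) (smooth_field_near sY) => y sXy sYy.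
  by rewrite (nabla_torsion lc sXy sYy).
apply: smooth_field_add; first exact: (nabla_smooth lc sX sY).
by apply: smooth_field_opp; exact: (nabla_smooth lc sY sX).
Qed.

Lemma lie_combr x f X Y Y' : smoothR f x -> smooth_field X x ->
  smooth_field Y x -> smooth_field Y' x ->
  lie X (fun y => f y *: Y y + Y' y) x =
    derR X f x *: Y x + f x *: lie X Y x + lie X Y' x.
Proof.
move=> sf sX sY sY'; rewrite (nabla_torsion lc sX (smooth_field_comb sf sY sY')).
rewrite (nabla_torsion lc sX sY) (nabla_torsion lc sX sY').
rewrite (nabla_combr lc sf sX sY sY') (nabla_combl lc sf sY sY' sX).
by apply/rowP => i; rewrite !mxE; ring.
Qed.

(** * Tensoriality of covariant derivatives *)

(** Covariant differentiation at [x] uses the values of a tensor around [x], so the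
    lemmas below assume this property at all nearby points. *)
Definition tensor2 S x := bitensorial x (fun Y Z => S Y Z x) /\
  forall Y Z, smooth_field Y x -> smooth_field Z x -> smoothR (S Y Z) x.

(** Swapping the arguments transfers statements on the first slot to the second. *)
Definition flip S : ftensor M := fun Y Z => S Z Y.

Lemma tensor2_flip S x : tensor2 S x -> tensor2 (flip S) x.
Proof. by move=> [[tl tr] s]; split; [split|move=> Y Z sY sZ; exact: s]. Qed.

Lemma tensor2_form h x : sym_tensor h -> tensor2 (on_fields h) x.
Proof.
move=> sh; split; last by move=> Y Z; exact: sym_tensor_smooth.
split=> [Z sZ f X Y _ _ _|Z sZ f X Y _ _ _]; first exact: (sform_linl sh).
exact: (sform_linr sh).
Qed.

Lemma cov_diff_flip S X Y Z x :
  cov_diff D X (flip S) Y Z x = cov_diff D X S Z Y x.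
Proof. by rewrite !cov_diffE /flip addrAC. Qed.

Lemma cov_diff_formC h X Y Z x : sym_tensor h ->
  cov_diff D X (on_fields h) Y Z x = cov_diff D X (on_fields h) Z Y x.
Proof.
move=> sh; have fE : flip (on_fields h) = on_fields h.
  by apply/funext => U; apply/funext => V; apply/funext => z; exact: (sform_sym sh).
by have := cov_diff_flip (on_fields h) X Y Z x; rewrite fE.
Qed.

(** The term [X f * S Y Z] from the derivative of [S (fY) Z] cancels against the one
    from the Leibniz rule for [D X (fY)]. *)
Lemma cov_diff_tensorial_arg S X Z x : (\forall y \near x, tensor2 S y) ->
  smooth_field X x -> smooth_field Z x ->
  tensorial x (fun Y => cov_diff D X S Y Z x).
Proof.
move=> tS sX sZ f Y Y' sf sY sY'; have [[tl tr] sS] := nbhs_singleton tS.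
have sXY := nabla_smooth lc sX sY; have sXY' := nabla_smooth lc sX sY'.
have sXZ := nabla_smooth lc sX sZ.
have SE : {near x, (fun y => f y * S Y Z y + S Y' Z y) =1
    S (fun y => f y *: Y y + Y' y) Z}.
  apply: filterS2 tS (filterI (filterI (smoothR_near sf) (smooth_field_near sZ))
    (filterI (smooth_field_near sY) (smooth_field_near sY'))).
  move=> y [[tly _] _] [[sfy sZy] [sYy sY'y]].
  by rewrite (tly _ sZy _ _ _ sfy sYy sY'y).
have DE : {near x, D X (fun y => f y *: Y y + Y' y) =1
    fun y => derR X f y *: Y y + (f y *: D X Y y + D X Y' y)}.
  exact: near_nabla_combr.
have sD : smooth_field (D X (fun y => f y *: Y y + Y' y)) x.
  exact: (nabla_smooth lc sX (smooth_field_comb sf sY sY')).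
rewrite !cov_diffE -(derR_congr X SE).
rewrite (derRD X (smoothR_mul sf (sS _ _ sY sZ)) (sS _ _ sY' sZ)).
rewrite (derRM X sf (sS _ _ sY sZ)).
rewrite (tensorial_congr (tl _ sZ) DE sD).
rewrite (tl _ sZ _ _ _ (smooth_derR sX sf) sY (smooth_field_comb sf sXY sXY')).
rewrite (tl _ sZ _ _ _ sf sXY sXY') (tl _ sXZ _ _ _ sf sY sY').
ring.
Qed.

Lemma tensor2_cov_diff S X x : (\forall y \near x, tensor2 S y) ->
  smooth_field X x -> tensor2 (cov_diff D X S) x.
Proof.
move=> tS sX; have [_ sS] := nbhs_singleton tS; split; first split=> Z sZ.
- exact: cov_diff_tensorial_arg.
- have tS' : \forall y \near x, tensor2 (flip S) y.
    by apply: filterS tS => y; exact: tensor2_flip.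
  move=> f Y Y' sf sY sY'.
  by have := cov_diff_tensorial_arg tS' sX sZ sf sY sY'; rewrite !(cov_diff_flip S).
- move=> Z Z' sZ sZ'.
  have := (smoothR_sub (smoothR_sub (smooth_derR sX (sS _ _ sZ sZ'))
    (sS _ _ (nabla_smooth lc sX sZ) sZ')) (sS _ _ sZ (nabla_smooth lc sX sZ'))).
  apply: smoothR_congr.
  by apply: nearW => y; rewrite cov_diffE.
Qed.

Lemma near_tensor2_cov_diff S X x : (\forall y \near x, tensor2 S y) ->
  smooth_field X x -> \forall y \near x, tensor2 (cov_diff D X S) y.
Proof.
move=> tS sX; apply: filterS2 (near_join tS) (smooth_field_near sX) => y tSy sXy.
exact: tensor2_cov_diff.
Qed.

Lemma cov_diff_tensorial_dir S Y Z x : (\forall y \near x, tensor2 S y) ->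
  smooth_field Y x -> smooth_field Z x ->
  tensorial x (fun X => cov_diff D X S Y Z x).
Proof.
move=> tS sY sZ f X X' sf sX sX'; have [[tl tr] sS] := nbhs_singleton tS.
have sXY := nabla_smooth lc sX sY; have sX'Y := nabla_smooth lc sX' sY.
have sXZ := nabla_smooth lc sX sZ; have sX'Z := nabla_smooth lc sX' sZ.
have DE Y' : smooth_field Y' x -> {near x, D (fun y => f y *: X y + X' y) Y' =1
    fun y => f y *: D X Y' y + D X' Y' y}.
  by move=> sY'; exact: near_nabla_combl.
have sD Y' : smooth_field Y' x -> smooth_field (D (fun y => f y *: X y + X' y) Y') x.
  exact: (nabla_smooth lc (smooth_field_comb sf sX sX')).
rewrite !cov_diffE (derR_comb _ _ _ (sS _ _ sY sZ)).
rewrite (tensorial_congr (tl _ sZ) (DE _ sY) (sD _ sY)).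
rewrite (tensorial_congr (tr _ sY) (DE _ sZ) (sD _ sZ)).
rewrite (tl _ sZ _ _ _ sf sXY sX'Y) (tr _ sY _ _ _ sf sXZ sX'Z).
ring.
Qed.

Lemma cov_diff_congr S X X' Y Z x : (\forall y \near x, tensor2 S y) ->
  {near x, X =1 X'} -> smooth_field X x -> smooth_field Y x -> smooth_field Z x ->
  cov_diff D X S Y Z x = cov_diff D X' S Y Z x.
Proof.
by move=> tS XX' sX sY sZ; exact: (tensorial_congr (cov_diff_tensorial_dir tS sY sZ) XX' sX).
Qed.

(** The second covariant derivative; the correction term makes it tensorial in [W]. *)
Definition hessian S X W Y Z x : R :=
  cov_diff D X (cov_diff D W S) Y Z x - cov_diff D (D X W) S Y Z x.

Lemma rough_laplacianE E S Y Z x :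
  rough_laplacian D E S Y Z x = - \sum_k hessian S (E k) (E k) Y Z x.
Proof. by []. Qed.

Lemma hessian_directions S Y Z x : (\forall y \near x, tensor2 S y) ->
  smooth_field Y x -> smooth_field Z x ->
  bitensorial x (fun X W => hessian S X W Y Z x).
Proof.
move=> tS sY sZ; split=> [W sW|X sX] f X1 X2 sf sX1 sX2.
  have tW := near_tensor2_cov_diff tS sW.
  have DE : {near x, D (fun y => f y *: X1 y + X2 y) W =1
      fun y => f y *: D X1 W y + D X2 W y}.
    exact: near_nabla_combl.
  have sD := nabla_smooth lc (smooth_field_comb sf sX1 sX2) sW.
  rewrite /hessian (cov_diff_tensorial_dir tW sY sZ sf sX1 sX2).
  rewrite (cov_diff_congr tS DE sD sY sZ).
  rewrite (cov_diff_tensorial_dir tS sY sZ sf (nabla_smooth lc sX1 sW) (nabla_smooth lc sX2 sW)).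
  ring.
have sXY := nabla_smooth lc sX sY; have sXZ := nabla_smooth lc sX sZ.
have DE : {near x, D X (fun y => f y *: X1 y + X2 y) =1
    fun y => derR X f y *: X1 y + (f y *: D X X1 y + D X X2 y)}.
  exact: near_nabla_combr.
have sD := nabla_smooth lc sX (smooth_field_comb sf sX1 sX2).
have s1 := nabla_smooth lc sX sX1; have s2 := nabla_smooth lc sX sX2.
have CE : {near x, (fun y => f y * cov_diff D X1 S Y Z y + cov_diff D X2 S Y Z y) =1
    cov_diff D (fun y => f y *: X1 y + X2 y) S Y Z}.
  apply: filterS2 (near_join tS) (filterI (filterI (smoothR_near sf)
    (filterI (smooth_field_near sY) (smooth_field_near sZ)))
    (filterI (smooth_field_near sX1) (smooth_field_near sX2))).
  move=> y tSy [[sfy [sYy sZy]] [s1y s2y]].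
  by rewrite (cov_diff_tensorial_dir tSy sYy sZy sfy s1y s2y).
have [_ sc1] := tensor2_cov_diff tS sX1; have [_ sc2] := tensor2_cov_diff tS sX2.
rewrite /hessian (cov_diff_congr tS DE sD sY sZ).
rewrite (cov_diff_tensorial_dir tS sY sZ (smooth_derR sX sf) sX1 (smooth_field_comb sf s1 s2)).
rewrite (cov_diff_tensorial_dir tS sY sZ sf s1 s2).
rewrite (cov_diffE D X (cov_diff D (fun y => f y *: X1 y + X2 y) S)).
rewrite -(derR_congr X CE).
rewrite (derRD X (smoothR_mul sf (sc1 _ _ sY sZ)) (sc2 _ _ sY sZ)).
rewrite (derRM X sf (sc1 _ _ sY sZ)).
rewrite (cov_diff_tensorial_dir tS sXY sZ sf sX1 sX2) (cov_diff_tensorial_dir tS sY sXZ sf sX1 sX2).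
rewrite (cov_diffE D X (cov_diff D X1 S)) (cov_diffE D X (cov_diff D X2 S)).
ring.
Qed.

Lemma hessian_arguments S X W x : (\forall y \near x, tensor2 S y) ->
  smooth_field X x -> smooth_field W x -> bitensorial x (fun Y Z => hessian S X W Y Z x).
Proof.
move=> tS sX sW.
have [[al ar] _] := tensor2_cov_diff (near_tensor2_cov_diff tS sW) sX.
have [[bl br] _] := tensor2_cov_diff tS (nabla_smooth lc sX sW).
by split=> Y sY; [exact: tensorialB (al _ sY) (bl _ sY)|exact: tensorialB (ar _ sY) (br _ sY)].
Qed.

End Covariant.

(** * Frame invariance of the Einstein operator *)

Section Curvature.
Context {R : realType} {n : nat} {M : manifold R n}.
Context (g : form2 M) (D : field M -> field M -> field M) (lc : levi_civita g D).
Context (sg : sym_tensor g).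
Implicit Types (x y : M) (X Y Z W : field M) (f : M -> R) (S : ftensor M).

Lemma curvatureE X Y Z x :
  curvature D X Y Z x = D X (D Y Z) x - D Y (D X Z) x - D (lie X Y) Z x.
Proof. by []. Qed.

Lemma curvature_anti X Y Z x : smooth_field X x -> smooth_field Y x -> smooth_field Z x ->
  curvature D X Y Z x = - curvature D Y X Z x.
Proof.
move=> sX sY sZ; rewrite !curvatureE.
have lE : {near x, lie X Y =1 fun y => - lie Y X y} by apply: nearW => y; exact: lieC.
move: (lie X Y) (lie Y X) lE (lie_smooth lc sX sY) (lie_smooth lc sY sX).
move=> L L' LE sL sL'; rewrite (nabla_congrl lc LE sL sZ) (nablaNl lc sL' sZ).
by apply/rowP => i; rewrite !mxE; ring.
Qed.

Lemma curvature_comb2 X f Y Y' Z x : smooth_field X x -> smoothR f x ->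
  smooth_field Y x -> smooth_field Y' x -> smooth_field Z x ->
  curvature D X (fun y => f y *: Y y + Y' y) Z x =
    f x *: curvature D X Y Z x + curvature D X Y' Z x.
Proof.
move=> sX sf sY sY' sZ.
have sXZ := nabla_smooth lc sX sZ; have sYZ := nabla_smooth lc sY sZ.
have sY'Z := nabla_smooth lc sY' sZ; have sc := smooth_field_comb sf sY sY'.
have lXY := lie_smooth lc sX sY; have lXY' := lie_smooth lc sX sY'.
have lE : {near x, lie X (fun y => f y *: Y y + Y' y) =1
    fun y => derR X f y *: Y y + (f y *: lie X Y y + lie X Y' y)}.
  apply: filterS (filterI (filterI (smoothR_near sf) (smooth_field_near sX))
    (filterI (smooth_field_near sY) (smooth_field_near sY'))).
  by move=> y [[sfy sXy] [sYy sY'y]]; rewrite addrA (lie_combr lc sfy sXy sYy sY'y).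
rewrite !curvatureE.
move: (lie X (fun y => f y *: Y y + Y' y)) (lie X Y) (lie X Y') lE lXY lXY'
  (lie_smooth lc sX sc) => Lc L L' lE lXY lXY' sLc.
rewrite (nabla_congrr lc (near_nabla_combl lc sf sY sY' sZ) sX (nabla_smooth lc sc sZ)).
rewrite (nabla_combr lc sf sX sYZ sY'Z) (nabla_combl lc sf sY sY' sXZ).
rewrite (nabla_congrl lc lE sLc sZ).
rewrite (nabla_combl lc (smooth_derR sX sf) sY (smooth_field_comb sf lXY lXY') sZ).
rewrite (nabla_combl lc sf lXY lXY' sZ).
by apply/rowP => i; rewrite !mxE; ring.
Qed.

Lemma curvature_comb1 f X X' Y Z x : smoothR f x ->
  smooth_field X x -> smooth_field X' x -> smooth_field Y x -> smooth_field Z x ->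
  curvature D (fun y => f y *: X y + X' y) Y Z x =
    f x *: curvature D X Y Z x + curvature D X' Y Z x.
Proof.
move=> sf sX sX' sY sZ; have sc := smooth_field_comb sf sX sX'.
rewrite (curvature_anti sc sY sZ) (curvature_comb2 sY sf sX sX' sZ).
rewrite (curvature_anti sX sY sZ) (curvature_anti sX' sY sZ).
move: (curvature D Y X Z x) (curvature D Y X' Z x) => U V.
by rewrite scalerN opprD.
Qed.

(** The second derivatives of [f] in the first two terms of the curvature form
    [X(Yf) - Y(Xf)], which is cancelled by the bracket in the third. *)
Lemma curvature_comb3 X Y f Z Z' x : smooth_field X x -> smooth_field Y x ->
  smoothR f x -> smooth_field Z x -> smooth_field Z' x ->
  curvature D X Y (fun y => f y *: Z y + Z' y) x =
    f x *: curvature D X Y Z x + curvature D X Y Z' x.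
Proof.
move=> sX sY sf sZ sZ'; have sc := smooth_field_comb sf sZ sZ'.
have second W W' : smooth_field W x -> smooth_field W' x ->
    D W (D W' (fun y => f y *: Z y + Z' y)) x =
    derR W (derR W' f) x *: Z x + derR W' f x *: D W Z x +
    (derR W f x *: D W' Z x + f x *: D W (D W' Z) x + D W (D W' Z') x).
  move=> sW sW'; have s1 := nabla_smooth lc sW' sZ; have s2 := nabla_smooth lc sW' sZ'.
  rewrite (nabla_congrr lc (near_nabla_combr lc sf sW' sZ sZ') sW (nabla_smooth lc sW' sc)).
  rewrite (nabla_combr lc (smooth_derR sW' sf) sW sZ (smooth_field_comb sf s1 s2)).
  by rewrite (nabla_combr lc sf sW s1 s2).
rewrite !curvatureE (second _ _ sX sY) (second _ _ sY sX).
move: (lie X Y) (lie_smooth lc sX sY) (diffR_lie sX sY sf) => L sL Lf.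
rewrite (nabla_combr lc sf sL sZ sZ') [derR L f x]Lf.
move: (derR X (derR Y f) x) (derR Y (derR X f) x) (derR X f x) (derR Y f x) => a b c d.
by apply/rowP => i; rewrite !mxE; ring.
Qed.

Lemma curvature_bitensorial Y w x : smooth_field Y x ->
  bitensorial x (fun X Z => g x (curvature D Y X Z x) w).
Proof.
move=> sY; split=> [Z sZ|X sX] f X1 X2 sf s1 s2.
  by rewrite (curvature_comb2 sY sf s1 s2 sZ) (sform_linl sg).
by rewrite (curvature_comb3 sY sX sf s1 s2) (sform_linl sg).
Qed.

Context (h : form2 M) (sh : sym_tensor h).
Local Notation H := (on_fields h).

Lemma near_tensor2_form x : \forall y \near x, tensor2 H y.
Proof. by apply: nearW => y; exact: tensor2_form. Qed.

Lemma einstein_operator_frame E E' Y Z x :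
  orthonormal_frame g E x -> orthonormal_frame g E' x ->
  smooth_field Y x -> smooth_field Z x ->
  einstein_operator g D E H Y Z x = einstein_operator g D E' H Y Z x.
Proof.
move=> onE onE' sY sZ; have [tH _] := tensor2_form x sh.
rewrite /einstein_operator !rough_laplacianE /curv_action.
rewrite (trace_frame sg onE onE' (hessian_directions lc (near_tensor2_form x) sY sZ)).
by rewrite (contract_frame sg onE onE' (curvature_bitensorial (Z x) sY) tH).
Qed.

Lemma einstein_operator_bitensorial E x : orthonormal_frame g E x ->
  bitensorial x (fun Y Z => einstein_operator g D E H Y Z x).
Proof.
move=> onE; have sE := frame_smooth onE.
have tL k := hessian_arguments lc (near_tensor2_form x) (sE k) (sE k).
split=> [Z sZ|Y sY]; apply: tensorialB.
- apply: tensorial_opp; apply: tensorial_big => k; exact: (tL k).1.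
- apply: tensorialMl; apply: tensorial_big => k; apply: tensorial_big => l.
  apply: tensorialMr => f X1 X2 sf s1 s2.
  by rewrite (curvature_comb1 sf s1 s2 (sE k) (sE l)) (sform_linl sg).
- apply: tensorial_opp; apply: tensorial_big => k; exact: (tL k).2.
- apply: tensorialMl; apply: tensorial_big => k; apply: tensorial_big => l.
  by apply: tensorialMr => f X1 X2 _ _ _; exact: (sform_linr sg).
Qed.

(** All four sums in this expression are contractions of tensors: the trace of the
    Hessian, the contraction of the curvature with [h], and the two sums of [inner]. *)
Theorem inner_einstein_frame E E' x :
  orthonormal_frame g E x -> orthonormal_frame g E' x ->
  inner E (einstein_operator g D E H) H x = inner E' (einstein_operator g D E' H) H x.
Proof.
move=> onE onE'; have [tH _] := tensor2_form x sh; rewrite /inner.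
rewrite (contract_frame sg onE onE' (einstein_operator_bitensorial onE) tH).
apply: eq_bigr => i _; apply: eq_bigr => j _; congr (_ * _).
exact: (einstein_operator_frame onE onE' (frame_smooth onE' i) (frame_smooth onE' j)).
Qed.

End Curvature.

(** * The Koszul formula and related fields *)

Section Koszul.
Context {R : realType} {n : nat} {M : manifold R n}.
Context (g : form2 M) (D : field M -> field M -> field M) (lc : levi_civita g D).
Context (sg : sym_tensor g).
Implicit Types (x y : M) (X Y Z W : field M) (f : M -> R).

Lemma koszul x X Y Z : smooth_field X x -> smooth_field Y x -> smooth_field Z x ->
  2 * g x (D X Y x) (Z x) =
    derR X (fun y => g y (Y y) (Z y)) x + derR Y (fun y => g y (X y) (Z y)) x
    - derR Z (fun y => g y (X y) (Y y)) x
    + g x (lie X Y x) (Z x) - g x (lie X Z x) (Y x) - g x (lie Y Z x) (X x).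
Proof.
move=> sX sY sZ.
rewrite (nabla_metric lc sX sY sZ) (nabla_metric lc sY sX sZ) (nabla_metric lc sZ sX sY).
rewrite (nabla_torsion lc sX sY) (nabla_torsion lc sX sZ) (nabla_torsion lc sY sZ).
rewrite !(sformDl sg) !(sformNl sg) !(sform_sym sg x (_ x) (D _ _ x)).
ring.
Qed.

Lemma lie0r x X : smooth_field X x -> lie X (fun _ => 0) x = 0.
Proof.
move=> sX; rewrite (nabla_torsion lc sX (@smooth_field0 _ _ _ x)).
by rewrite (nabla0r lc sX) (nabla0l lc sX) subrr.
Qed.

(** Nondegeneracy, tested on fields: the coordinate fields with constant coefficients
    give a field through any tangent vector, in particular through [u - v]. *)
Lemma form_inj x u v : (forall w, w != 0 -> 0 < g x w w) ->
  (forall Z, smooth_field Z x -> g x u (Z x) = g x v (Z x)) -> u = v.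
Proof.
move=> pos uv; apply/eqP; rewrite -subr_eq0; apply/negPn/negP => uv0.
pose Z : field M := fun y => \sum_i (u - v) 0 i *: coord_field x i y.
have xx := dom_center x.
have ZE : Z x = u - v.
  rewrite /Z [RHS](coord_field_expand _ xx); apply: eq_bigr => i _.
  by rewrite tdiff_crd.
have sZ : smooth_field Z x.
  apply: smooth_field_sum => i; apply: smooth_field_scale.
    exact: smoothR_cst.
  exact: smooth_coord_field.
have := pos _ uv0; rewrite -{2}ZE (sformDl sg) (sformNl sg) (uv Z sZ) subrr.
by rewrite ltxx.
Qed.

End Koszul.

Section Related.
Context {R : realType} {m n : nat} {M : manifold R m} {N : manifold R n}.
Context (p : M -> N) (sp : forall x, smooth_map p x).

(** Brackets of [p]-related fields are [p]-related, because both brackets are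
    commutators of derivations, and these correspond under composition with [p]. *)
Lemma push_lie x (X Y : field M) (X' Y' : field N) :
  smooth_field X x -> smooth_field Y x ->
  smooth_field X' (p x) -> smooth_field Y' (p x) ->
  (\forall y \near x, push p y (X y) = X' (p y)) ->
  (\forall y \near x, push p y (Y y) = Y' (p y)) ->
  push p x (lie X Y x) = lie X' Y' (p x).
Proof.
move=> sX sY sX' sY' rX rY; have bb := dom_center (p x).
apply/rowP => i.
have sf : smoothR (fun z => crd (p x) z 0 i) (p x) by exact: smoothR_crd.
have sfp := smoothR_map (sp x) sf.
have commute (U V : field M) (U' V' : field N) :
    smooth_field U x -> smooth_field U' (p x) -> smooth_field V' (p x) ->
    (\forall y \near x, push p y (U y) = U' (p y)) ->
    (\forall y \near x, push p y (V y) = V' (p y)) ->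
  derR U (derR V ((fun z => crd (p x) z 0 i) \o p)) x =
  derR U' (derR V' (fun z => crd (p x) z 0 i)) (p x).
  move=> sU sU' sV' rU rV.
  have VE : {near x, derR V ((fun z => crd (p x) z 0 i) \o p) =1
      derR V' (fun z => crd (p x) z 0 i) \o p}.
    have nsf : \forall y \near x, smoothR (fun z => crd (p x) z 0 i) (p y).
      exact: smooth_map_near (sp x) (smoothR_near sf).
    apply: filterS2 rV nsf => y rVy sfy.
    exact: derR_map (sp y) sfy rVy.
  rewrite (derR_congr U VE).
  exact: derR_map (sp x) (smooth_derR sV' sf) (nbhs_singleton rU).
have [_ scp] := sp x.
have lE : diffR (fun z => crd (p x) z 0 i) (p x) (lie X' Y' (p x)) = lie X' Y' (p x) 0 i.
  by rewrite (tdiff_coord _ i (smooth_crd bb)) tdiff_crd.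
rewrite -lE (diffR_lie sX' sY' sf).
rewrite -(commute X Y X' Y' sX sX' sY' rX rY) -(commute Y X Y' X' sY sY' sX' rY rX).
rewrite -(diffR_lie sX sY sfp).
by symmetry; exact: tdiff_coord scp.
Qed.

End Related.

Section Submersion.
Context {R : realType} {n : nat} {M : manifold R n.+1} {B : manifold R n}.
Context (g : form2 M) (G : form2 B) (J : endo B) (p : M -> B) (eta : form1 M).
Context (Dg : field M -> field M -> field M) (DG : field B -> field B -> field B).
Context (sg : sym_tensor g) (gpos : forall y u, u != 0 -> 0 < g y u u).
Context (sG : sym_tensor G) (Gpos : forall b u, u != 0 -> 0 < G b u u).
Context (sJ : smooth_endo J) (J2 : forall b u, J b (J b u) = - u).
Context (herm : forall b u v, G b (J b u) (J b v) = G b u v).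
Context (seta : smooth_form1 eta).
Context (deta : forall y X Y, smooth_field X y -> smooth_field Y y ->
  ext_diff1 eta X Y y = 2 * pullback p (kahler_form G J) y (X y) (Y y)).
Context (gE : forall y u v, g y u v = pullback p G y u v + eta y u * eta y v).
Context (sp : forall y, smooth_map p y) (surj : forall y w, exists v, push p y v = w).
Context (lcg : levi_civita g Dg) (lcG : levi_civita G DG).
Implicit Types (X Y Z W : field B) (y : M) (b : B) (U V : field M).

(** * The Reeb field and horizontal lifts *)

Lemma eta_linear y c u v : eta y (c *: u + v) = c * eta y u + eta y v.
Proof. by case: seta => + _; apply. Qed.

Lemma eta0 y : eta y 0 = 0.
Proof.
have := eta_linear y 1 0 0; rewrite scaler0 addr0 mul1r => /eqP.
by rewrite -subr_eq subrr eq_sym => /eqP.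
Qed.

Lemma etaD y u v : eta y (u + v) = eta y u + eta y v.
Proof. by rewrite -{1}[u]scale1r eta_linear mul1r. Qed.

Lemma etaZ y c u : eta y (c *: u) = c * eta y u.
Proof. by rewrite -[c *: u]addr0 eta_linear eta0 addr0. Qed.

Lemma push0 y : push p y 0 = 0.
Proof. exact: tdiff0. Qed.

Lemma pushD y u v : push p y (u + v) = push p y u + push p y v.
Proof. by rewrite -{1}[u]scale1r (push_linear _ _ _ (sp y)) scale1r. Qed.

Lemma pushZ y c u : push p y (c *: u) = c *: push p y u.
Proof. by rewrite -[c *: u]addr0 (push_linear _ _ _ (sp y)) push0 addr0. Qed.

Lemma pushN y u : push p y (- u) = - push p y u.
Proof. by rewrite -scaleN1r pushZ scaleN1r. Qed.

Lemma push_sum y k (u : 'I_k -> 'rV[R]_n.+1) : push p y (\sum_i u i) = \sum_i push p y (u i).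
Proof.
elim: k u => [|k IH] u; first by rewrite !big_ord0 push0.
by rewrite !big_ord_recr pushD IH.
Qed.

(** Definiteness of [g]: a vector killed by [push] and [eta] has norm zero. *)
Lemma split_inj y u v : push p y u = push p y v -> eta y u = eta y v -> u = v.
Proof.
move=> uv euv; apply/eqP; rewrite -subr_eq0; apply/negPn/negP => /(gpos y).
rewrite gE /pullback pushD pushN uv subrr (sform0l sG) add0r.
by rewrite etaD -scaleN1r etaZ euv mulN1r subrr mul0r ltxx.
Qed.

(** By dimension the kernel of [push] contains a nonzero vector, and [eta] cannot
    vanish on it because [g] is definite. *)
Lemma vertical_vector y : exists w, push p y w = 0 /\ eta y w = 1.
Proof.
pose A : 'M[R]_(n.+1, n) := \matrix_i push p y (delta_mx 0 i).
have AE v : push p y v = v *m A.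
  rewrite {1}[v]row_sum_delta push_sum mulmx_sum_row; apply: eq_bigr => i _.
  by rewrite pushZ rowK.
have : kermx A != 0.
  by rewrite kermx_eq0 /row_free neq_ltn ltnS rank_leq_col.
move=> /rowV0Pn[v /sub_kermxP vA v0].
have ev : eta y v != 0.
  apply/eqP => ev; have := gpos y v0.
  by rewrite gE /pullback AE vA (sform0l sG) ev mul0r addr0 ltxx.
exists ((eta y v)^-1 *: v); rewrite pushZ etaZ AE vA scaler0 mulVf//.
Qed.

Context (E : 'I_n.+1 -> field M).

(** The vertical field normalised by [eta], given as the metric dual of [eta]: in
    this form it is visibly smooth. *)
Definition reeb : field M := fun y => \sum_i eta y (E i y) *: E i y.

(** The horizontal lift of [X], written through the components it must have in the
    frame [E], namely the values of [g] on the lift and [E i]. *)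
Definition hlift X : field M :=
  fun y => \sum_i G (p y) (X (p y)) (push p y (E i y)) *: E i y.

Section at_point.
Context (y : M) (onE : orthonormal_frame g E y).

Lemma reebP : push p y (reeb y) = 0 /\ eta y (reeb y) = 1.
Proof.
have [w [pw ew]] := vertical_vector y.
suff -> : reeb y = w by [].
rewrite [RHS](frame_expand sg onE); apply: eq_bigr => i _.
by rewrite gE /pullback pw (sform0l sG) add0r ew mul1r.
Qed.

Lemma hliftP X : push p y (hlift X y) = X (p y) /\ eta y (hlift X y) = 0.
Proof.
have [w [pw ew]] := vertical_vector y; have [v pv] := surj y (X (p y)).
pose v' := - eta y v *: w + v.
have pv' : push p y v' = X (p y) by rewrite (push_linear _ _ _ (sp y)) pw scaler0 add0r.
have ev' : eta y v' = 0 by rewrite eta_linear ew mulr1 addNr.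
suff -> : hlift X y = v' by [].
rewrite [RHS](frame_expand sg onE); apply: eq_bigr => i _.
by rewrite gE ev' mul0r addr0 /pullback pv'.
Qed.

Lemma smooth_reeb : smooth_field reeb y.
Proof.
apply: smooth_field_sum => i; have sE := frame_smooth onE i.
exact: smooth_field_scale (form1_smooth seta sE) sE.
Qed.

Lemma smooth_push_form (h : form2 B) X U : sym_tensor h ->
  smooth_field X (p y) -> smooth_field U y ->
  smoothR (fun z => h (p z) (X (p z)) (push p z (U z))) y.
Proof.
move=> sh sX sU; have [c [sc cE]] := push_expand (sp y) sU sp.
have bb := dom_center (p y).
apply: (@smoothR_congr _ _ _ (fun z => \sum_i c i z *
    ((fun b => h b (X b) (coord_field (p y) i b)) \o p) z)).
  apply: filterS cE => z ->; rewrite (sform_sumr sh); apply: eq_bigr => i _.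
  by rewrite (sformZr sh).
apply: smoothR_sum => i; apply: smoothR_mul; first exact: sc.
exact: smoothR_map (sp y) (sform_smooth sh sX (smooth_coord_field i bb)).
Qed.

Lemma smooth_hlift X : smooth_field X (p y) -> smooth_field (hlift X) y.
Proof.
move=> sX; apply: smooth_field_sum => i; have sE := frame_smooth onE i.
exact: smooth_field_scale (smooth_push_form sG sX sE) sE.
Qed.

Lemma g_hlift X u : g y (hlift X y) u = G (p y) (X (p y)) (push p y u).
Proof. by have [pX eX] := hliftP X; rewrite gE /pullback pX eX mul0r addr0. Qed.

Lemma g_reeb u : g y (reeb y) u = eta y u.
Proof.
by have [pX eX] := reebP; rewrite gE /pullback pX eX (sform0l sG) add0r mul1r.
Qed.

End at_point.

Lemma smooth_pullback_form (h : form2 B) y U V : sym_tensor h ->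
  smooth_field U y -> smooth_field V y ->
  smoothR (fun z => pullback p h z (U z) (V z)) y.
Proof.
move=> sh sU sV; have [c [sc cE]] := push_expand (sp y) sU sp.
have bb := dom_center (p y).
apply: (@smoothR_congr _ _ _ (fun z => \sum_i c i z *
    (h (p z) (coord_field (p y) i (p z)) (push p z (V z))))).
  apply: filterS cE => z; rewrite /pullback => ->; rewrite (sform_suml sh).
  by apply: eq_bigr => i _; rewrite (sformZl sh).
apply: smoothR_sum => i; apply: smoothR_mul; first exact: sc.
exact: smooth_push_form sh (smooth_coord_field i bb) sV.
Qed.

(** * The Levi-Civita connection on horizontal lifts *)

Lemma Jlinear b c u v : J b (c *: u + v) = c *: J b u + J b v.
Proof. by case: sJ => + _; apply. Qed.

Lemma J0 b : J b 0 = 0.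
Proof.
have := Jlinear b 1 0 0; rewrite scaler0 addr0 scale1r => /eqP.
by rewrite -subr_eq subrr eq_sym => /eqP.
Qed.

Lemma JZ b c u : J b (c *: u) = c *: J b u.
Proof. by rewrite -[c *: u]addr0 Jlinear J0 addr0. Qed.

Lemma JD b u v : J b (u + v) = J b u + J b v.
Proof. by rewrite -{1}[u]scale1r Jlinear scale1r. Qed.

Lemma J_sum b k (u : 'I_k -> 'rV[R]_n) : J b (\sum_i u i) = \sum_i J b (u i).
Proof.
elim: k u => [|k IH] u; first by rewrite !big_ord0 J0.
by rewrite !big_ord_recr JD IH.
Qed.

Lemma J_skew b u v : G b (J b u) v = - G b u (J b v).
Proof. by rewrite -(herm b (J b u) v) J2 (sformNl sG). Qed.

Definition Jfield X : field B := fun b => J b (X b).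

Lemma smooth_Jfield b X : smooth_field X b -> smooth_field (Jfield X) b.
Proof. by case: sJ => _; apply. Qed.

(** The Kaehler form up to sign; with this sign it is the vertical component of
    [Dg] on lifts. *)
Definition omega X Y b : R := G b (J b (X b)) (Y b).

Lemma smooth_omega b X Y : smooth_field X b -> smooth_field Y b -> smoothR (omega X Y) b.
Proof. by move=> sX sY; exact: (sform_smooth sG (smooth_Jfield sX) sY). Qed.

Lemma omega_alt X b : omega X X b = 0.
Proof.
have := J_skew b (X b) (X b); rewrite (sform_sym sG b (X b)) /omega.
move: (G b (J b (X b)) (X b)) => a; lra.
Qed.

Section nabla_at_point.
Context (y : M) (onE : orthonormal_frame g E y).

Lemma hlift_near X :
  \forall z \near y, push p z (hlift X z) = X (p z) /\ eta z (hlift X z) = 0.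
Proof. by apply: filterS (frame_near onE) => z onEz; exact: hliftP. Qed.

Lemma reeb_near : \forall z \near y, push p z (reeb z) = 0 /\ eta z (reeb z) = 1.
Proof. by apply: filterS (frame_near onE) => z onEz; exact: reebP. Qed.

Lemma derR_hlift X (k : B -> R) (f : M -> R) : smoothR k (p y) ->
  {near y, f =1 k \o p} -> derR (hlift X) f y = derR X k (p y).
Proof.
move=> sk fk; rewrite (derR_congr _ fk).
exact: derR_map (sp y) sk (hliftP onE X).1.
Qed.

Lemma derR_reeb (k : B -> R) (f : M -> R) : smoothR k (p y) ->
  {near y, f =1 k \o p} -> derR reeb f y = 0.
Proof.
move=> sk fk; rewrite (derR_congr _ fk).
rewrite (derR_map (X' := fun=> 0) (sp y) sk (reebP onE).1).
exact: derR0.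
Qed.

Lemma derR_const U (f : M -> R) a : {near y, f =1 fun=> a} -> derR U f y = 0.
Proof. by move=> fa; rewrite (derR_congr _ fa) derR_cst. Qed.

Lemma push_lie_hlift X Y : smooth_field X (p y) -> smooth_field Y (p y) ->
  push p y (lie (hlift X) (hlift Y) y) = lie X Y (p y).
Proof.
move=> sX sY; apply: (push_lie sp (smooth_hlift onE sX) (smooth_hlift onE sY) sX sY).
  by apply: filterS (hlift_near X) => z [].
by apply: filterS (hlift_near Y) => z [].
Qed.

Lemma eta_lie U V (a c : R) : smooth_field U y -> smooth_field V y ->
  {near y, (fun z => eta z (U z)) =1 fun=> a} -> {near y, (fun z => eta z (V z)) =1 fun=> c} ->
  eta y (lie U V y) = - 2 * pullback p (kahler_form G J) y (U y) (V y).
Proof.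
move=> sU sV Ua Vb; have := deta sU sV.
rewrite ext_diff1E (derR_const U Vb) (derR_const V Ua) => dE.
by rewrite mulNr -dE; ring.
Qed.

(** The bracket of two lifts fails to be horizontal by the curvature [d eta]. *)
Lemma eta_lie_hlift X Y : smooth_field X (p y) -> smooth_field Y (p y) ->
  eta y (lie (hlift X) (hlift Y) y) = 2 * omega X Y (p y).
Proof.
move=> sX sY; rewrite (eta_lie (a := 0) (c := 0) (smooth_hlift onE sX) (smooth_hlift onE sY)).
- rewrite /pullback /kahler_form (hliftP onE X).1 (hliftP onE Y).1.
  by rewrite /omega J_skew mulNr mulrN.
- by apply: filterS (hlift_near X) => z [].
- by apply: filterS (hlift_near Y) => z [].
Qed.

(** The bracket is vertical since [reeb] is related to the zero field, and [eta]
    vanishes on it since [reeb] is in the kernel of [d eta]. *)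
Lemma lie_hlift_reeb X : smooth_field X (p y) -> lie (hlift X) reeb y = 0.
Proof.
move=> sX; have s0 := @smooth_field0 R n B (p y).
have sh := smooth_hlift onE sX; have sr := smooth_reeb onE.
apply: (@split_inj y).
  rewrite push0 -(lie0r lcG sX); apply: (push_lie sp sh sr sX s0).
    by apply: filterS (hlift_near X) => z [].
  by apply: filterS reeb_near => z [].
rewrite eta0 (eta_lie (a := 0) (c := 1) sh sr).
- by rewrite /pullback /kahler_form (reebP onE).1 J0 (sform0r sG) mulr0.
- by apply: filterS (hlift_near X) => z [].
- by apply: filterS reeb_near => z [].
Qed.

Lemma lie_reeb_hlift X : smooth_field X (p y) -> lie reeb (hlift X) y = 0.
Proof. by move=> sX; rewrite lieC (lie_hlift_reeb sX) oppr0. Qed.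

Lemma near_g_hlift X Y : {near y, (fun z => g z (hlift X z) (hlift Y z)) =1
  (fun b => G b (X b) (Y b)) \o p}.
Proof.
apply: filterS (frame_near onE) => z onEz.
by rewrite (g_hlift onEz) (hliftP onEz Y).1.
Qed.

Lemma near_g_hlift_reeb X : {near y, (fun z => g z (hlift X z) (reeb z)) =1 fun=> 0}.
Proof.
apply: filterS (frame_near onE) => z onEz.
by rewrite (g_hlift onEz) (reebP onEz).1 (sform0r sG).
Qed.

Lemma near_g_reeb_hlift X : {near y, (fun z => g z (reeb z) (hlift X z)) =1 fun=> 0}.
Proof.
apply: filterS (frame_near onE) => z onEz.
by rewrite (g_reeb onEz) (hliftP onEz X).2.
Qed.

Lemma near_g_reeb : {near y, (fun z => g z (reeb z) (reeb z)) =1 fun=> 1}.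
Proof.
apply: filterS (frame_near onE) => z onEz.
by rewrite (g_reeb onEz) (reebP onEz).2.
Qed.

Lemma g_hliftr u Z : g y u (hlift Z y) = G (p y) (push p y u) (Z (p y)).
Proof. by rewrite (sform_sym sg) (g_hlift onE) (sform_sym sG). Qed.

Lemma push_eqP u w : (forall Z, smooth_field Z (p y) ->
  g y u (hlift Z y) = G (p y) w (Z (p y))) -> push p y u = w.
Proof.
move=> H; apply: (form_inj sG (@Gpos (p y))) => Z sZ.
by rewrite -(H Z sZ) g_hliftr.
Qed.

Lemma eta_g u : eta y u = g y u (reeb y).
Proof. by rewrite (sform_sym sg) (g_reeb onE). Qed.

(** All terms of the Koszul formula on lifts are pulled back from [B]. *)
Lemma push_nabla_hlift X Y : smooth_field X (p y) -> smooth_field Y (p y) ->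
  push p y (Dg (hlift X) (hlift Y) y) = DG X Y (p y).
Proof.
move=> sX sY; apply: push_eqP => Z sZ.
have hX := smooth_hlift onE sX; have hY := smooth_hlift onE sY.
have hZ := smooth_hlift onE sZ.
apply: (@mulfI _ (2 : R)); first by rewrite pnatr_eq0.
rewrite (koszul lcg sg hX hY hZ) (koszul lcG sG sX sY sZ).
have lieE X1 Y1 Z1 : smooth_field X1 (p y) -> smooth_field Y1 (p y) ->
    g y (lie (hlift X1) (hlift Y1) y) (hlift Z1 y) = G (p y) (lie X1 Y1 (p y)) (Z1 (p y)).
  by move=> sX1 sY1; rewrite g_hliftr (push_lie_hlift sX1 sY1).
have sum6 (a1 a2 a3 a4 a5 a6 b1 b2 b3 b4 b5 b6 : R) : a1 = b1 -> a2 = b2 -> a3 = b3 ->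
    a4 = b4 -> a5 = b5 -> a6 = b6 ->
    a1 + a2 - a3 + a4 - a5 - a6 = b1 + b2 - b3 + b4 - b5 - b6.
  by move=> -> -> -> -> -> ->.
apply: sum6.
- exact: derR_hlift (sform_smooth sG sY sZ) (near_g_hlift Y Z).
- exact: derR_hlift (sform_smooth sG sX sZ) (near_g_hlift X Z).
- exact: derR_hlift (sform_smooth sG sX sY) (near_g_hlift X Y).
- exact: lieE.
- exact: lieE.
- exact: lieE.
Qed.

Lemma eta_nabla_hlift X Y : smooth_field X (p y) -> smooth_field Y (p y) ->
  eta y (Dg (hlift X) (hlift Y) y) = omega X Y (p y).
Proof.
move=> sX sY; rewrite eta_g; have sr := smooth_reeb onE.
have hX := smooth_hlift onE sX; have hY := smooth_hlift onE sY.
apply: (@mulfI _ (2 : R)); first by rewrite pnatr_eq0.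
rewrite (koszul lcg sg hX hY sr) (lie_hlift_reeb sX) (lie_hlift_reeb sY).
rewrite (derR_const _ (near_g_hlift_reeb Y)) (derR_const _ (near_g_hlift_reeb X)).
rewrite (derR_reeb (sform_smooth sG sX sY) (near_g_hlift X Y)).
by rewrite !(sform0l sg) -eta_g (eta_lie_hlift sX sY); ring.
Qed.

(** Horizontally [Dg] is the lift of [DG]; the vertical part is half of the vertical
    part of the bracket. *)
Lemma nabla_hlift X Y : smooth_field X (p y) -> smooth_field Y (p y) ->
  Dg (hlift X) (hlift Y) y = omega X Y (p y) *: reeb y + hlift (DG X Y) y.
Proof.
move=> sX sY; have [pr er] := reebP onE; have [ph eh] := hliftP onE (DG X Y).
apply: (@split_inj y).
  by rewrite (push_nabla_hlift sX sY) (push_linear _ _ _ (sp y)) pr scaler0 add0r ph.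
by rewrite (eta_nabla_hlift sX sY) eta_linear er mulr1 eh addr0.
Qed.

(** Metric compatibility turns the vertical part of [Dg] on lifts into the derivative
    of [reeb]. *)
Lemma nabla_hlift_reeb X : smooth_field X (p y) ->
  Dg (hlift X) reeb y = - hlift (Jfield X) y.
Proof.
move=> sX; have [ph eh] := hliftP onE (Jfield X).
have sr := smooth_reeb onE; have hX := smooth_hlift onE sX.
apply: (@split_inj y).
  rewrite pushN ph; apply: push_eqP => Z sZ; have hZ := smooth_hlift onE sZ.
  have := nabla_metric lcg hX sr hZ; rewrite (derR_const _ (near_g_reeb_hlift Z)).
  rewrite (g_reeb onE) (eta_nabla_hlift sX sZ) => /esym/eqP.
  by rewrite addr_eq0 (sformNl sG) => /eqP.
have := nabla_metric lcg hX sr sr; rewrite (derR_const _ near_g_reeb).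
rewrite (g_reeb onE) (sform_sym sg) (g_reeb onE) => er.
by rewrite -scaleN1r etaZ eh mulr0; lra.
Qed.

Lemma nabla_reeb_hlift X : smooth_field X (p y) ->
  Dg reeb (hlift X) y = - hlift (Jfield X) y.
Proof.
move=> sX; have sr := smooth_reeb onE; have hX := smooth_hlift onE sX.
rewrite -(nabla_hlift_reeb sX); apply/eqP.
by rewrite -subr_eq0 -(nabla_torsion lcg sr hX) (lie_reeb_hlift sX).
Qed.

Lemma nabla_reeb_reeb : Dg reeb reeb y = 0.
Proof.
have sr := smooth_reeb onE; apply: (@split_inj y).
  rewrite push0; apply: push_eqP => Z sZ; have hZ := smooth_hlift onE sZ.
  have [_ eh] := hliftP onE (Jfield Z).
  have := nabla_metric lcg sr sr hZ; rewrite (derR_const _ (near_g_reeb_hlift Z)).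
  rewrite (g_reeb onE) (nabla_reeb_hlift sZ) -scaleN1r etaZ eh mulr0 addr0 => <-.
  by rewrite (sform0l sG).
have := nabla_metric lcg sr sr sr; rewrite (derR_const _ near_g_reeb).
rewrite (g_reeb onE) (sform_sym sg) (g_reeb onE) eta0 => er.
lra.
Qed.

End nabla_at_point.

(** * Pulled back tensors *)

Context (h : form2 B) (sh : sym_tensor h).
Local Notation H := (on_fields h).
Local Notation Ht := (on_fields (pullback p h)).

Lemma sym_tensor_pullback : sym_tensor (pullback p h).
Proof.
apply: sym_tensorI => [y c u v w|y u v|y U V sU sV].
- by rewrite /pullback (push_linear _ _ _ (sp y)) (sform_linl sh).
- exact: (sform_sym sh).
- exact: smooth_pullback_form.
Qed.

Section tensor_at_point.
Context (y : M) (onE : orthonormal_frame g E y).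

Let tHt := near_tensor2_form sym_tensor_pullback y.
Let tH := near_tensor2_form sh (p y).

Lemma smooth_field_p X : smooth_field X (p y) -> \forall z \near y, smooth_field X (p z).
Proof. by move=> /smooth_field_near; exact: smooth_map_near. Qed.

Lemma Ht_hlift Y Z : Ht (hlift Y) (hlift Z) y = H Y Z (p y).
Proof. by rewrite /on_fields /pullback (hliftP onE Y).1 (hliftP onE Z).1. Qed.

Lemma Ht_reeb V : Ht reeb V y = 0.
Proof. by rewrite /on_fields /pullback (reebP onE).1 (sform0l sh). Qed.

Lemma near_Ht_hlift Y Z : {near y, Ht (hlift Y) (hlift Z) =1 H Y Z \o p}.
Proof.
apply: filterS (filterI (hlift_near onE Y) (hlift_near onE Z)) => z [[pY _] [pZ _]].
by rewrite /on_fields /pullback pY pZ.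
Qed.

Lemma cov_diff_hlift X Y Z :
  smooth_field X (p y) -> smooth_field Y (p y) -> smooth_field Z (p y) ->
  cov_diff Dg (hlift X) Ht (hlift Y) (hlift Z) y = cov_diff DG X H Y Z (p y).
Proof.
move=> sX sY sZ.
rewrite !cov_diffE (derR_hlift onE X (sym_tensor_smooth sh sY sZ) (near_Ht_hlift Y Z)).
rewrite /on_fields /pullback (push_nabla_hlift onE sX sY) (push_nabla_hlift onE sX sZ).
by rewrite (hliftP onE Y).1 (hliftP onE Z).1.
Qed.

Lemma near_Ht_reeb V : {near y, Ht reeb V =1 fun=> 0}.
Proof.
apply: filterS (reeb_near onE) => z [pr _].
by rewrite /on_fields /pullback pr (sform0l sh).
Qed.

(** The pulled back tensor vanishes on [reeb], but its covariant derivative does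
    not, because [reeb] is not parallel. *)
Lemma cov_diff_hlift_reeb X Z : smooth_field X (p y) ->
  cov_diff Dg (hlift X) Ht reeb (hlift Z) y = H (Jfield X) Z (p y).
Proof.
move=> sX; rewrite cov_diffE (derR_const _ (near_Ht_reeb _)) Ht_reeb.
rewrite /on_fields /pullback (nabla_hlift_reeb onE sX) pushN.
by rewrite (hliftP onE (Jfield X)).1 (hliftP onE Z).1 (sformNl sh); ring.
Qed.

(** Along the fibres the pulled back tensor is constant on lifts; only the rotation
    of the lifts by [J] contributes. *)
Lemma cov_diff_reeb Y Z : smooth_field Y (p y) -> smooth_field Z (p y) ->
  cov_diff Dg reeb Ht (hlift Y) (hlift Z) y =
    H (Jfield Y) Z (p y) + H Y (Jfield Z) (p y).
Proof.
move=> sY sZ.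
rewrite cov_diffE (derR_reeb onE (sym_tensor_smooth sh sY sZ) (near_Ht_hlift Y Z)).
rewrite /on_fields /pullback (nabla_reeb_hlift onE sY) (nabla_reeb_hlift onE sZ) !pushN.
rewrite (hliftP onE (Jfield Y)).1 (hliftP onE (Jfield Z)).1.
by rewrite (hliftP onE Y).1 (hliftP onE Z).1 (sformNl sh) (sformNr sh); ring.
Qed.

End tensor_at_point.

Section hessian_at_point.
Context (y : M) (onE : orthonormal_frame g E y).

Let tHt := near_tensor2_form sym_tensor_pullback y.
Let tH := near_tensor2_form sh (p y).

Lemma near_nabla_hlift X Y : smooth_field X (p y) -> smooth_field Y (p y) ->
  {near y, Dg (hlift X) (hlift Y) =1
    fun z => (omega X Y \o p) z *: reeb z + hlift (DG X Y) z}.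
Proof.
move=> sX sY.
apply: filterS (filterI (frame_near onE) (filterI (smooth_field_p sX) (smooth_field_p sY))).
by move=> z [onEz [sXz sYz]]; exact: (nabla_hlift onEz sXz sYz).
Qed.

Lemma cov_diff_hlift_nabla X Y Z :
  smooth_field X (p y) -> smooth_field Y (p y) -> smooth_field Z (p y) ->
  cov_diff Dg (hlift X) Ht (Dg (hlift X) (hlift Y)) (hlift Z) y =
    omega X Y (p y) * H (Jfield X) Z (p y) + cov_diff DG X H (DG X Y) Z (p y).
Proof.
move=> sX sY sZ; have sr := smooth_reeb onE.
have hX := smooth_hlift onE sX; have hY := smooth_hlift onE sY.
have hZ := smooth_hlift onE sZ; have sXY := nabla_smooth lcG sX sY.
have T := cov_diff_tensorial_arg lcg tHt hX hZ.
have som := smoothR_map (sp y) (smooth_omega sX sY).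
rewrite (tensorial_congr T (near_nabla_hlift sX sY) (nabla_smooth lcg hX hY)).
rewrite (T _ _ _ som sr (smooth_hlift onE sXY)).
by rewrite (cov_diff_hlift_reeb onE Z sX) (cov_diff_hlift onE sX sXY sZ).
Qed.

(** The two terms in [omega] come from the vertical parts of [Dg X Y] and [Dg X Z],
    on which the covariant derivative of the pulled back tensor does not vanish. *)
Lemma hessian_hlift X Y Z :
  smooth_field X (p y) -> smooth_field Y (p y) -> smooth_field Z (p y) ->
  hessian Dg Ht (hlift X) (hlift X) (hlift Y) (hlift Z) y =
    hessian DG H X X Y Z (p y) - omega X Y (p y) * H (Jfield X) Z (p y)
    - omega X Z (p y) * H (Jfield X) Y (p y).
Proof.
move=> sX sY sZ; have sXX := nabla_smooth lcG sX sX.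
have hX := smooth_hlift onE sX; have hY := smooth_hlift onE sY.
have hZ := smooth_hlift onE sZ.
have CE : {near y, cov_diff Dg (hlift X) Ht (hlift Y) (hlift Z) =1
    cov_diff DG X H Y Z \o p}.
  apply: filterS (filterI (filterI (frame_near onE) (smooth_field_p sX))
    (filterI (smooth_field_p sY) (smooth_field_p sZ))).
  by move=> z [[onEz sXz] [sYz sZz]]; exact: (cov_diff_hlift onEz sXz sYz sZz).
have e1 := derR_hlift onE X ((tensor2_cov_diff lcG tH sX).2 _ _ sY sZ) CE.
have e2 := cov_diff_hlift_nabla sX sY sZ.
have e3 := cov_diff_hlift_nabla sX sZ sY.
have XX : {near y, Dg (hlift X) (hlift X) =1 hlift (DG X X)}.
  apply: filterS (filterI (frame_near onE) (smooth_field_p sX)) => z [onEz sXz].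
  by rewrite (nabla_hlift onEz sXz sXz) omega_alt scale0r add0r.
have e4 := cov_diff_congr lcg tHt XX (nabla_smooth lcg hX hX) hY hZ.
have e5 := cov_diff_hlift onE sXX sY sZ.
have e6 := cov_diff_formC DG X (DG X Z) Y (p y) sh.
rewrite /hessian e4 e5 (cov_diffE Dg (hlift X) (cov_diff Dg (hlift X) Ht)) e1 e2.
rewrite (cov_diff_formC Dg _ (hlift Y) _ _ sym_tensor_pullback) e3 e6.
rewrite (cov_diffE DG X (cov_diff DG X H)).
ring.
Qed.

(** The operator [h |-> h (J, .) + h (., J)] of [cov_diff_reeb] applied twice; the
    square of [J] in each slot gives [- h], each of the two mixed terms [h (J, J)]. *)
Lemma hessian_reeb Y Z : smooth_field Y (p y) -> smooth_field Z (p y) ->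
  hessian Dg Ht reeb reeb (hlift Y) (hlift Z) y =
    2 * H (Jfield Y) (Jfield Z) (p y) - 2 * H Y Z (p y).
Proof.
move=> sY sZ; have sr := smooth_reeb onE.
have hY := smooth_hlift onE sY; have hZ := smooth_hlift onE sZ.
have sJY := smooth_Jfield sY; have sJZ := smooth_Jfield sZ.
have hJY := smooth_hlift onE sJY; have hJZ := smooth_hlift onE sJZ.
have CE : {near y, cov_diff Dg reeb Ht (hlift Y) (hlift Z) =1
    (fun b => H (Jfield Y) Z b + H Y (Jfield Z) b) \o p}.
  apply: filterS (filterI (frame_near onE) (filterI (smooth_field_p sY) (smooth_field_p sZ))).
  by move=> z [onEz [sYz sZz]]; exact: (cov_diff_reeb onEz sYz sZz).
have e1 := derR_reeb onE (smoothR_add (sym_tensor_smooth sh sJY sZ)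
  (sym_tensor_smooth sh sY sJZ)) CE.
have nE X : smooth_field X (p y) -> {near y, Dg reeb (hlift X) =1 fun z => - hlift (Jfield X) z}.
  move=> sX; apply: filterS (filterI (frame_near onE) (smooth_field_p sX)) => z [onEz sXz].
  exact: (nabla_reeb_hlift onEz sXz).
have JJ X b : Jfield (Jfield X) b = - X b by exact: J2.
have e2 X1 Y1 : smooth_field X1 (p y) -> smooth_field Y1 (p y) ->
    cov_diff Dg reeb Ht (Dg reeb (hlift X1)) (hlift Y1) y =
    H X1 Y1 (p y) - H (Jfield X1) (Jfield Y1) (p y).
  move=> sX1 sY1; have hY1 := smooth_hlift onE sY1; have sJX := smooth_Jfield sX1.
  have T := cov_diff_tensorial_arg lcg tHt sr hY1.
  rewrite (tensorial_congr T (nE X1 sX1) (nabla_smooth lcg sr (smooth_hlift onE sX1))).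
  rewrite (tensorialN T (smooth_hlift onE sJX)) (cov_diff_reeb onE sJX sY1).
  by rewrite {1}/on_fields JJ (sformNl sh) /on_fields; ring.
have e3 : cov_diff Dg (Dg reeb reeb) Ht (hlift Y) (hlift Z) y = 0.
  have rr : {near y, Dg reeb reeb =1 fun=> 0}.
    by apply: filterS (frame_near onE) => z onEz; exact: (nabla_reeb_reeb onEz).
  rewrite (cov_diff_congr lcg tHt rr (nabla_smooth lcg sr sr) hY hZ).
  exact: (tensorial0 (cov_diff_tensorial_dir lcg tHt hY hZ)).
rewrite /hessian e3 (cov_diffE Dg reeb (cov_diff Dg reeb Ht)) e1 (e2 Y Z sY sZ).
rewrite (cov_diff_formC Dg _ (hlift Y) _ _ sym_tensor_pullback) (e2 Z Y sZ sY).
rewrite /on_fields (sform_sym sh (p y) (Z (p y))) (sform_sym sh (p y) (Jfield Z (p y))).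
ring.
Qed.

End hessian_at_point.

(** * Curvature on horizontal lifts *)

Section curvature_at_point.
Context (y : M) (onE : orthonormal_frame g E y).

Lemma push_nabla_vertical_part X (f : B -> R) Y :
  smooth_field X (p y) -> smoothR f (p y) -> smooth_field Y (p y) ->
  push p y (Dg (hlift X) (fun z => (f \o p) z *: reeb z + hlift Y z) y) =
    DG X Y (p y) - f (p y) *: J (p y) (X (p y)).
Proof.
move=> sX sf sY; have sr := smooth_reeb onE; have hX := smooth_hlift onE sX.
rewrite (nabla_combr lcg (smoothR_map (sp y) sf) hX sr (smooth_hlift onE sY)).
rewrite pushD (push_nabla_hlift onE sX sY) pushD !pushZ (reebP onE).1 scaler0 add0r.
rewrite (nabla_hlift_reeb onE sX) pushN (hliftP onE (Jfield X)).1 scalerN.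
exact: addrC.
Qed.

Lemma push_nabla_nabla X Y Z :
  smooth_field X (p y) -> smooth_field Y (p y) -> smooth_field Z (p y) ->
  push p y (Dg (hlift X) (Dg (hlift Y) (hlift Z)) y) =
    DG X (DG Y Z) (p y) - omega Y Z (p y) *: J (p y) (X (p y)).
Proof.
move=> sX sY sZ; have hX := smooth_hlift onE sX.
have hYZ := nabla_smooth lcg (smooth_hlift onE sY) (smooth_hlift onE sZ).
rewrite (nabla_congrr lcg (near_nabla_hlift onE sY sZ) hX hYZ).
exact: (push_nabla_vertical_part sX (smooth_omega sY sZ) (nabla_smooth lcG sY sZ)).
Qed.

Lemma near_lie_hlift X Y : smooth_field X (p y) -> smooth_field Y (p y) ->
  {near y, lie (hlift X) (hlift Y) =1
    fun z => ((fun b => 2 * omega X Y b) \o p) z *: reeb z + hlift (lie X Y) z}.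
Proof.
move=> sX sY.
apply: filterS (filterI (frame_near onE) (filterI (smooth_field_p sX) (smooth_field_p sY))).
move=> z [onEz [sXz sYz]]; have [pr er] := reebP onEz.
have [ph eh] := hliftP onEz (lie X Y); apply: (@split_inj z).
  by rewrite (push_lie_hlift onEz sXz sYz) pushD pushZ pr scaler0 add0r ph.
by rewrite (eta_lie_hlift onEz sXz sYz) etaD etaZ er mulr1 eh addr0.
Qed.

Lemma push_nabla_lie X Y Z :
  smooth_field X (p y) -> smooth_field Y (p y) -> smooth_field Z (p y) ->
  push p y (Dg (lie (hlift X) (hlift Y)) (hlift Z) y) =
    DG (lie X Y) Z (p y) - (2 * omega X Y (p y)) *: J (p y) (Z (p y)).
Proof.
move=> sX sY sZ; have sr := smooth_reeb onE; have hZ := smooth_hlift onE sZ.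
have s2 : smoothR (fun b => 2 * omega X Y b) (p y).
  exact: smoothR_mul (smoothR_cst 2 _) (smooth_omega sX sY).
have hXY := lie_smooth lcg (smooth_hlift onE sX) (smooth_hlift onE sY).
have sXY := lie_smooth lcG sX sY; have lE := near_lie_hlift sX sY.
move: (lie (hlift X) (hlift Y)) (lie X Y) hXY sXY lE => L L' hL sL lE.
rewrite (nabla_congrl lcg lE hL hZ).
rewrite (nabla_combl lcg (smoothR_map (sp y) s2) sr (smooth_hlift onE sL) hZ).
rewrite pushD pushZ (push_nabla_hlift onE sL sZ) (nabla_reeb_hlift onE sZ) pushN.
by rewrite (hliftP onE (Jfield Z)).1 scalerN addrC.
Qed.

(** O'Neill's formula for the horizontal part of the curvature: the first two
    correction terms come from differentiating the vertical parts of [Dg] on lifts,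
    the last one from the vertical part of the bracket. *)
Lemma push_curvature X Y Z :
  smooth_field X (p y) -> smooth_field Y (p y) -> smooth_field Z (p y) ->
  push p y (curvature Dg (hlift X) (hlift Y) (hlift Z) y) =
    curvature DG X Y Z (p y)
    + (omega X Z (p y) *: J (p y) (Y (p y)) - omega Y Z (p y) *: J (p y) (X (p y))
       + (2 * omega X Y (p y)) *: J (p y) (Z (p y))).
Proof.
move=> sX sY sZ; rewrite !curvatureE.
have e1 := push_nabla_nabla sX sY sZ; have e2 := push_nabla_nabla sY sX sZ.
have e3 := push_nabla_lie sX sY sZ.
rewrite !pushD !pushN e1 e2 e3.
move: (DG X (DG Y Z) (p y)) (DG Y (DG X Z) (p y)) (DG (lie X Y) Z (p y)) => a b c.
move: (omega Y Z (p y)) (omega X Z (p y)) (omega X Y (p y)) => o1 o2 o3.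
by apply/rowP => i; rewrite !mxE; ring.
Qed.

End curvature_at_point.

(** * The adapted frame *)

Lemma form_comb_sum b k (e : 'I_k -> 'rV[R]_n) (a c : 'I_k -> R) :
  \sum_i \sum_j a i * c j * h b (e i) (e j) =
  h b (\sum_i a i *: e i) (\sum_j c j *: e j).
Proof.
rewrite (sform_suml sh); apply: eq_bigr => i _.
rewrite (sform_sumr sh); apply: eq_bigr => j _.
by rewrite (sformZl sh) (sformZr sh) mulrA.
Qed.

Section frame_at_point.
Context (b : B) (F : 'I_n -> field B) (onF : orthonormal_frame G F b).

(** Summing the corrections of [hessian_hlift] over the frame: [J] is skew, so this
    expands [- h (J (J u)) w]. *)
Lemma sum_omega_J u w :
  \sum_k G b (J b (F k b)) u * h b (J b (F k b)) w = h b u w.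
Proof.
rewrite -[u in RHS]opprK -(J2 b u) (frame_expand sG onF (J b u)) J_sum (sformNl sh).
rewrite (sform_suml sh) -sumrN; apply: eq_bigr => k _.
by rewrite JZ (sformZl sh) J_skew (sform_sym sG b (F k b)) mulNr.
Qed.

(** A skew tensor contracted with a symmetric one. *)
Lemma sum_omega_symmetric :
  \sum_k \sum_l G b (J b (F k b)) (F l b) * h b (F k b) (F l b) = 0.
Proof.
set S := LHS; suff : S = - S by lra.
rewrite {1}/S exchange_big -sumrN; apply: eq_bigr => k _.
rewrite -sumrN; apply: eq_bigr => l _.
by rewrite J_skew (sform_sym sG) (sform_sym sh b (F l b)) mulNr.
Qed.

(** Expands [h (J u) (J w)] in the frame; the sign is that of [J_skew]. *)
Lemma sum_omega_omega u w :
  \sum_k \sum_l G b (J b (F k b)) w * G b (J b u) (F l b) * h b (F k b) (F l b)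
  = - h b (J b u) (J b w).
Proof.
rewrite (form_comb_sum b (fun k => F k b) (fun k => G b (J b (F k b)) w)
  (fun l => G b (J b u) (F l b))) -(frame_expand sG onF (J b u)).
rewrite (sform_sym sh b (J b u)) -(sformNl sh); congr (h b _ _).
rewrite [in RHS](frame_expand sG onF (J b w)) -sumrN; apply: eq_bigr => k _.
by rewrite J_skew (sform_sym sG b (F k b)) scaleNr.
Qed.

End frame_at_point.

Context (y : M) (onE : orthonormal_frame g E y).
Context (F : 'I_n -> field B) (onF : orthonormal_frame G F (p y)).

Let tHt := near_tensor2_form sym_tensor_pullback y.
Let tH := near_tensor2_form sh (p y).

Definition adapted_frame (i : 'I_n.+1) : field M :=
  if unlift ord_max i is Some j then hlift (F j) else reeb.

Lemma adapted_frame_max : adapted_frame ord_max = reeb.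
Proof. by rewrite /adapted_frame unlift_none. Qed.

Lemma adapted_frame_widen j : adapted_frame (widen_ord (leqnSn n) j) = hlift (F j).
Proof.
rewrite /adapted_frame (_ : widen_ord _ j = lift ord_max j) ?liftK//.
by apply: ord_inj; rewrite lift_max.
Qed.

Lemma sum_adapted_frame (f : field M -> R) :
  \sum_i f (adapted_frame i) = \sum_j f (hlift (F j)) + f reeb.
Proof.
rewrite big_ord_recr /= adapted_frame_max; congr (_ + _).
by apply: eq_bigr => j _; rewrite adapted_frame_widen.
Qed.

Lemma adapted_frame_orthonormal : orthonormal_frame g adapted_frame y.
Proof.
have sF := frame_smooth onF; split=> [i|].
  rewrite /adapted_frame; case: unlift => [j|]; last exact: smooth_reeb.
  exact: (smooth_hlift onE (sF j)).
have nF : \forall z \near y, orthonormal_frame G F (p z).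
  exact: smooth_map_near (sp y) (frame_near onF).
apply: filterS2 (frame_near onE) nF => z onEz onFz i j.
rewrite /adapted_frame; case: (unliftP ord_max i) => [i' ->|->];
  case: (unliftP ord_max j) => [j' ->|->].
- rewrite (g_hlift onEz) (hliftP onEz _).1 (frameE onFz).
  by rewrite (inj_eq lift_inj).
- rewrite (g_hlift onEz) (reebP onEz).1 (sform0r sG).
  by rewrite eq_sym (negbTE (neq_lift _ _)).
- by rewrite (g_reeb onEz) (hliftP onEz _).2 (negbTE (neq_lift _ _)).
- by rewrite (g_reeb onEz) (reebP onEz).2 eqxx.
Qed.

(** Each of the two slots contributes [H] from the horizontal directions, and the
    direction [reeb] contributes [2 H - 2 H (J, J)]. *)
Lemma rough_laplacian_hlift Y Z : smooth_field Y (p y) -> smooth_field Z (p y) ->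
  rough_laplacian Dg adapted_frame Ht (hlift Y) (hlift Z) y =
    rough_laplacian DG F H Y Z (p y) + 4 * H Y Z (p y)
    - 2 * H (Jfield Y) (Jfield Z) (p y).
Proof.
move=> sY sZ; have sF := frame_smooth onF; rewrite !rough_laplacianE.
rewrite (sum_adapted_frame (fun U => hessian Dg Ht U U (hlift Y) (hlift Z) y)).
rewrite (hessian_reeb onE sY sZ).
rewrite (eq_bigr _ (fun k _ => hessian_hlift onE (sF k) sY sZ)) !sumrB.
rewrite (sum_omega_J onF (Y (p y)) (Z (p y))) (sum_omega_J onF (Z (p y)) (Y (p y))).
rewrite (sform_sym sh (p y) (Z (p y))) /on_fields; ring.
Qed.

(** Of the three correction terms in [push_curvature] one vanishes by symmetry of
    [h], and the others contribute [- H (J, J)] and [- 2 H (J, J)]. *)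
Lemma curv_action_hlift Y Z : smooth_field Y (p y) -> smooth_field Z (p y) ->
  curv_action g Dg adapted_frame Ht (hlift Y) (hlift Z) y =
    curv_action G DG F H Y Z (p y) - 3 * H (Jfield Y) (Jfield Z) (p y).
Proof.
move=> sY sZ; have sF := frame_smooth onF; rewrite /curv_action.
pose b := p y.
rewrite (sum_adapted_frame (fun U => \sum_l g y (curvature Dg (hlift Y) U (adapted_frame l) y)
  (hlift Z y) * Ht U (adapted_frame l) y)).
rewrite [X in _ + X]big1 ?addr0 => [|l _]; last by rewrite (Ht_reeb onE) mulr0.
have termE k : \sum_l g y (curvature Dg (hlift Y) (hlift (F k)) (adapted_frame l) y)
    (hlift Z y) * Ht (hlift (F k)) (adapted_frame l) y =
  \sum_l G b (curvature DG Y (F k) (F l) b) (Z b) * H (F k) (F l) b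
  + \sum_l G b (J b (F k b)) (Z b) * G b (J b (Y b)) (F l b) * h b (F k b) (F l b)
  - G b (J b (Y b)) (Z b) * \sum_l G b (J b (F k b)) (F l b) * h b (F k b) (F l b)
  + 2 * \sum_l G b (J b (F l b)) (Z b) * G b (J b (Y b)) (F k b) * h b (F l b) (F k b).
  rewrite (sum_adapted_frame (fun U => g y (curvature Dg (hlift Y) (hlift (F k)) U y)
    (hlift Z y) * Ht (hlift (F k)) U y)).
  rewrite [X in _ + X](_ : _ = 0); last first.
    rewrite -[Ht _ _ _]/(flip Ht reeb (hlift (F k)) y).
    by rewrite /flip /on_fields (sform_sym sym_tensor_pullback)
      -/(on_fields _ reeb (hlift (F k)) y) (Ht_reeb onE) mulr0.
  rewrite addr0 !mulr_sumr -big_split -sumrB -big_split; apply: eq_bigr => l _ /=.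
  rewrite (g_hliftr onE) (push_curvature onE sY (sF k) (sF l)) (Ht_hlift onE).
  move: (curvature DG Y (F k) (F l) (p y)) => C.
  rewrite !(sformDl sG) (sformNl sG) !(sformZl sG) /omega /on_fields -/b.
  rewrite (sform_sym sh b (F l b) (F k b)).
  ring.
have swap : \sum_k \sum_l G b (J b (F l b)) (Z b) * G b (J b (Y b)) (F k b)
    * h b (F l b) (F k b) = - h b (J b (Y b)) (J b (Z b)).
  by rewrite exchange_big; exact: sum_omega_omega.
rewrite (eq_bigr _ (fun k _ => termE k)) !big_split /= sumrN -!mulr_sumr swap.
rewrite (sum_omega_symmetric b F) (sum_omega_omega onF (Y b) (Z b)).
rewrite /on_fields /Jfield -/b; ring.
Qed.

Lemma einstein_operator_hlift Y Z : smooth_field Y (p y) -> smooth_field Z (p y) ->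
  einstein_operator g Dg adapted_frame Ht (hlift Y) (hlift Z) y =
    einstein_operator G DG F H Y Z (p y) + 4 * H Y Z (p y)
    + 4 * on_fields (comp_endo h J) Y Z (p y).
Proof.
move=> sY sZ; rewrite /einstein_operator (rough_laplacian_hlift sY sZ).
rewrite (curv_action_hlift sY sZ).
rewrite -[on_fields (comp_endo h J) Y Z (p y)]/(H (Jfield Y) (Jfield Z) (p y)).
ring.
Qed.

(** In the adapted frame the sums run over lifts only, as the pulled back tensor
    vanishes on [reeb]. *)
Theorem inner_einstein_operator_pullback :
  inner E (einstein_operator g Dg E Ht) Ht y =
  inner F (einstein_operator G DG F H) H (p y)
  + 4 * inner F H H (p y) + 4 * inner F (on_fields (comp_endo h J)) H (p y).
Proof.
have sF := frame_smooth onF.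
rewrite (inner_einstein_frame lcg sg sym_tensor_pullback onE adapted_frame_orthonormal).
rewrite /inner (sum_adapted_frame (fun U => \sum_j
  einstein_operator g Dg adapted_frame Ht U (adapted_frame j) y * Ht U (adapted_frame j) y)).
rewrite [X in _ + X]big1 ?addr0 => [|j _]; last by rewrite (Ht_reeb onE) mulr0.
rewrite !mulr_sumr -!big_split; apply: eq_bigr => i _ /=.
rewrite (sum_adapted_frame (fun U =>
  einstein_operator g Dg adapted_frame Ht (hlift (F i)) U y * Ht (hlift (F i)) U y)).
rewrite [X in _ + X](_ : _ = 0); last first.
  rewrite /on_fields (sform_sym sym_tensor_pullback).
  by rewrite -/(on_fields _ reeb (hlift (F i)) y) (Ht_reeb onE) mulr0.
rewrite addr0 !mulr_sumr -!big_split; apply: eq_bigr => j _ /=.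
rewrite (einstein_operator_hlift (sF i) (sF j)) (Ht_hlift onE); ring.
Qed.

End Submersion.

Theorem theorem1p3 (R : realType) (p : nat)
  (M : manifold R (2 * p).+1) (B : manifold R (2 * p))
  (g : form2 M) (G : form2 B) (J : endo B)
  (pi : M -> B) (L : R) (act : R -> M -> M) (eta : form1 M)
  (nablag : field M -> field M -> field M)
  (nablaG : field B -> field B -> field B)
  (cg cG : R)
  (sasaki : regular_sasaki g G J pi L act eta)
  (submersion : riemannian_submersion g G pi)
  (lcg : levi_civita g nablag)
  (lcG : levi_civita G nablaG)
  (einsteing : einstein g nablag cg)
  (einsteinG : einstein G nablaG cG)
  (h : form2 B) (hsym : sym_tensor h)
  (x : M) (E : 'I_(2 * p).+1 -> field M) (F : 'I_(2 * p) -> field B)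
  (onE : orthonormal_frame g E x) (onF : orthonormal_frame G F (pi x)) :
  let H := on_fields h in
  let Ht := on_fields (pullback pi h) in
  let HJ := on_fields (comp_endo h J) in
  inner E (einstein_operator g nablag E Ht) Ht x =
  inner F (einstein_operator G nablaG F H) H (pi x)
  + 4 * inner F H H (pi x) + 4 * inner F HJ H (pi x).
Proof.
case: sasaki => kal _ [seta _ _] deta [sg gpos] gE.
case: kal => [[sG Gpos] sJ J2 herm _ _].
case: submersion => sp _ surj _.
exact: (inner_einstein_operator_pullback sg gpos sG Gpos sJ J2 herm seta deta gE sp
  surj lcg lcG hsym onE onF).
Qed.
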